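(* Let $k$ be a positive integer, $n\ge 2k$ and $\lambda\vdash n$. For each of the algebras $A_k\in\{P_k(n),\ \mathbb{C}S_k,\ B_k(n),\ R_k(n),\ RB_k(n),\ TL_k(n),\ M_k(n),\ PR_k(n),\ PP_k(n)\}$, let $V^{\overline\lambda}_{A_k}$ be the irreducible $A_k$-representation indexed by $\overline\lambda$ (where $\overline\lambda$ belongs to the index set of irreducible representations of $A_k$). Then $$\dim\bigl(V^{\overline\lambda}_{A_k}\bigr)=\#\mathrm{SMT}_{A_k}(\lambda).$$
   Context: **Partitions and tableaux.** $[k]=\{1,\ldots,k\}$. For $\lambda=(\lambda_1,\lambda_2,\ldots,\lambda_r)$, $\overline\lambda=(\lambda_2,\ldots,\lambda_r)$. The diagram of $\lambda$ has $\lambda_j$ left-justified cells in row $j$; row $1$ is the first row. Last letter order: for disjoint non-empty sets $X,Y\subseteq[k]$, $X<Y$ if $\max X<\max Y$; the empty set is smaller than every non-empty set. A standard multiset tableau of shape $\lambda$ and content $[k]$ is a filling of the cells of $\lambda$ by subsets of $[k]$ (the empty set may label several cells) such that every letter of $[k]$ lies in exactly one entry, entries weakly increase along rows from left to right, and strictly increase in each column from row $j$ to row $j+1$. A standard multiset tableau is *matching* if its first row contains only sets of size at most $2$ and all other rows contain only sets of size $1$. Two sets $X,X'$ are *non-crossing* if there are no $a,b\in X$, $c,d\in X'$ with $a<c<b<d$ or $c<a<d<b$; a letter $c$ is *between* a set $X$ if there are $a,b\in X$ with $a<c<b$. A standard multiset tableau is *planar* if it has at most two rows, the sets in its first row are pairwise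 non-crossing, and no element belonging to a set in the second row is between any set in the tableau (apart from the set containing that element). $\mathrm{SMT}_{A_k}(\lambda)$ is the set of standard multiset tableaux of shape $\lambda$ and content $[k]$ such that: for $P_k(n)$, no condition; for $PP_k(n)$, planar; for $\mathbb{C}S_k$, matching with first-row entries all of size $0$; for $B_k(n)$, matching with first-row entries of sizes in $\{0,2\}$; for $R_k(n)$, matching with first-row sizes in $\{0,1\}$; for $RB_k(n)$, matching with first-row sizes in $\{0,1,2\}$; for $TL_k(n)$, matching and planar with first-row sizes in $\{0,2\}$; for $M_k(n)$, matching and planar with first-row sizes in $\{0,1,2\}$; for $PR_k(n)$, matching and planar with first-row sizes in $\{0,1\}$. **Algebras.** $P_k(n)$ is the partition algebra over $\mathbb{C}$: its basis is the set partitions (diagrams) of $[k]\cup\{\overline1,\ldots,\overline k\}$, and the product of two diagrams is obtained by stacking one above the other, identifying the bottom vertices of the upper one with the top vertices of the lower one, deleting the connected components lying entirely in the middle row, and multiplying by $n^{c}$, where $c$ is the number of deleted components. $A_{k-1}$ is embedded in $A_k$ by adding the block $\{k,\overline{k}\}$. The subalgebras are spanned by: all diagrams ($P_k(n)$); permutations ($\mathbb{C}S_k$); perfect matchings (Brauer, $B_k(n)$); partial permutations (rook, $R_k(n)$); matchings (rook-Brauer, $RB_k(n)$); planar perfect matchings (Temperley–Lieb, $TL_k(n)$); planar matchings (Motzkin, $M_k(n)$); planar partial permutations (planar rook, $PR_k(n)$); planar diagrams ($PP_k(n)$). Here a matching has all blocks of size at most $2$, a perfect matching has all blocks of size $2$,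 a partial permutation is a matching whose blocks of size $2$ all meet both $[k]$ and $\{\overline1,\ldots,\overline k\}$, and a permutation is a perfect matching that is a partial permutation; planar means drawable without crossings inside the rectangle with $1,\ldots,k$ on the top row and $\overline1,\ldots,\overline k$ on the bottom row. **Irreducible representations (known).** The irreducibles $V^\nu_{A_k}$ are indexed by partitions $\nu$ as follows: $P_k(n), R_k(n), RB_k(n)$: $0\le|\nu|\le k$; $\mathbb{C}S_k$: $|\nu|=k$; $B_k(n)$: $|\nu|=k-2r$, $0\le 2r\le k$; $TL_k(n)$: $\nu=(k-2r)$, $0\le 2r\le k$; $M_k(n), PR_k(n), PP_k(n)$: $\nu=(m)$, $0\le m\le k$ (with $(0)=\emptyset$). The algebra $A_0$ has a single irreducible, $V^{\emptyset}_{A_0}$, of dimension $1$. The indexing is the standard one, for which the restriction of $V^\nu_{A_k}$ to $A_{k-1}$ is a direct sum of irreducibles, $V^{\nu'}_{A_{k-1}}$ (with $\nu'$ in the index set of $A_{k-1}$) occurring with the following multiplicity (all partitions involved having at most one row for $TL,M,PR,PP$): - $P_k(n)$, $PP_k(n)$: the number of $\rho$ such that $\rho$ is obtained from $\nu$ by removing $1$ or $0$ cells and $\nu'$ is obtained from $\rho$ by adding $1$ or $0$ cells; - $\mathbb{C}S_k$: $1$ if $\nu'$ is obtained from $\nu$ by removing a cell; - $B_k(n)$, $TL_k(n)$: $1$ if $\nu'$ is obtained from $\nu$ by adding or removing a cell; - $R_k(n)$, $PR_k(n)$: $1$ if $\nu'$ is obtained from $\nu$ by removing $1$ or $0$ cells;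 - $RB_k(n)$, $M_k(n)$: $1$ if $\nu'=\nu$ or $\nu'$ is obtained from $\nu$ by adding or removing one cell; and $0$ otherwise. *)

(* Defs.v *)
From HB Require Import structures.
From mathcomp Require Import all_boot all_order all_algebra.
Set Implicit Arguments. Unset Strict Implicit. Unset Printing Implicit Defensive.
Import GRing.Theory.
Local Open Scope ring_scope.

Inductive alg_family : Set :=
  | Partition        (* P_k(n)  *)
  | Symmetric        (* C S_k   *)
  | Brauer           (* B_k(n)  *)
  | Rook             (* R_k(n)  *)
  | RookBrauer       (* RB_k(n) *)
  | TemperleyLieb    (* TL_k(n) *)
  | Motzkin          (* M_k(n)  *)
  | PlanarRook       (* PR_k(n) *)
  | PlanarPartition. (* PP_k(n) *)

(** * Integer partitions, as lists of their parts; the partition obtained from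
      [la] by deleting its first row is [behead la] *)

Definition is_part (la : seq nat) : bool := sorted geq la && (0%N \notin la).

Definition partition_of (n : nat) (la : seq nat) : bool :=
  is_part la && (sumn la == n).

(* [nu] is obtained from [mu] by adding a cell, for partitions [mu], [nu]
   (row [size mu] is a new row). *)
Definition adds_cell (mu nu : seq nat) : bool :=
  has (fun i => nu == incr_nth mu i) (iota 0 (size mu).+1).

Definition adds_at_most_one_cell (mu nu : seq nat) : bool :=
  (nu == mu) || adds_cell mu nu.

(* The partitions obtained from [nu] by removing one or no cell, without
   repetition. The lists [decr i] contain all of them (a part that becomes [0]
   is dropped), and possibly other lists, which the filter discards. *)
Definition removals (nu : seq nat) : seq (seq nat) :=
  let decr i :=
    [seq x <- set_nth 0%N nu i (nth 0%N nu i).-1 | x != 0%N] in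
  [seq rho <- undup (nu :: [seq decr i | i <- iota 0 (size nu)])
     | is_part rho && adds_at_most_one_cell rho nu].

(** * Set partitions of [k] + [k-bar] *)

(* [inl i] is the vertex i of the top row, [inr i] the vertex i-bar of the
   bottom row; the letters 1, ..., k are the ordinals 0, ..., k - 1. *)
Definition vertex (k : nat) : finType := ('I_k + 'I_k)%type.

Record diagram (k : nat) := Diagram {
  blocks :> {set {set vertex k}};
  blocksP : partition blocks [set: vertex k] }.

HB.instance Definition _ k := [isSub for @blocks k].
HB.instance Definition _ k := [Finite of diagram k by <:].

Fact id_diagram_subproof k :
  partition (preim_partition
    (fun v : vertex k => match v with inl i => i | inr i => i end) setT) setT.
Proof. exact: preim_partitionP. Qed.

Definition id_diagram k : diagram k := Diagram (id_diagram_subproof k).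

(* Stacking [d1] above [d2]: the top row is [inl (inl i)], the identified middle
   row is [inl (inr i)], the bottom row is [inr i]. *)
Definition stacked (k : nat) : finType := (vertex k + 'I_k)%type.

Definition upper k (v : vertex k) : stacked k := inl v.

Definition lower k (v : vertex k) : stacked k :=
  match v with inl i => inl (inr i) | inr i => inr i end.

Definition outer k (v : vertex k) : stacked k :=
  match v with inl i => inl (inl i) | inr i => inr i end.

Definition middle k (i : 'I_k) : stacked k := inl (inr i).

Definition adjacent k (d1 d2 : diagram k) : rel (stacked k) := fun x y =>
  [exists B in blocks d1, (x \in @upper k @: B) && (y \in @upper k @: B)]
  || [exists B in blocks d2, (x \in @lower k @: B) && (y \in @lower k @: B)].

Lemma connect_adjacent_equiv k (d1 d2 : diagram k) :
  equivalence_rel (connect (adjacent d1 d2)).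
Proof.
have S : connect_sym (adjacent d1 d2).
  apply: sym_connect_sym => x y; rewrite /adjacent.
  by congr orb; apply: eq_existsb => B; rewrite [X in _ && X]andbC.
by move=> x y z; split=> // xy; apply: same_connect.
Qed.

Definition compose_blocks k (d1 d2 : diagram k) : {set {set vertex k}} :=
  equivalence_partition
    (fun u v => connect (adjacent d1 d2) (outer u) (outer v)) setT.

Fact compose_subproof k (d1 d2 : diagram k) :
  partition (compose_blocks d1 d2) setT.
Proof.
by apply: equivalence_partitionP => u v w _ _ _; apply: connect_adjacent_equiv.
Qed.

Definition compose k (d1 d2 : diagram k) : diagram k :=
  Diagram (compose_subproof d1 d2).

Definition num_deleted k (d1 d2 : diagram k) : nat :=
  #|[set C in equivalence_partition (connect (adjacent d1 d2)) setT
       | C \subset [set @middle k i | i : 'I_k]]|.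

Definition widen_vertex k (v : vertex k) : vertex k.+1 :=
  match v with
  | inl i => inl (widen_ord (leqnSn k) i)
  | inr i => inr (widen_ord (leqnSn k) i)
  end.

Definition last_block k : {set vertex k.+1} := [set inl ord_max; inr ord_max].

Definition embed_blocks k (d : diagram k) : {set {set vertex k.+1}} :=
  last_block k |: [set @widen_vertex k @: B | B : {set vertex k} in blocks d].

Lemma widen_vertex_inj k : injective (@widen_vertex k).
Proof. by move=> [] i [] j //= [] ij; congr (_ _); apply: val_inj. Qed.

Lemma widen_vertexN k (v : vertex k) : widen_vertex v \notin last_block k.
Proof.
rewrite !inE negb_or; case: v => i; apply/andP; split=> //;
  by apply/eqP => - [] /eqP; rewrite ltn_eqF.
Qed.

Fact embed_subproof k (d : diagram k) : partition (embed_blocks d) setT.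
Proof.
have /and3P[/eqP cov tri n0] := blocksP d.
apply/and3P; split.
- rewrite eqEsubset subsetT /=; apply/subsetP => v _; rewrite /cover.
  have [vl|vNl] := boolP (v \in last_block k).
    by apply/bigcupP; exists (last_block k) => //; rewrite setU11.
  have [w ->] : exists w : vertex k, v = widen_vertex w.
    move: vNl; rewrite !inE negb_or; case: v => i /andP[].
      move=> ni _; have ik : (i < k)%N.
        rewrite ltn_neqAle -ltnS ltn_ord andbT; apply: contra ni => /eqP ik.
        by apply/eqP; congr inl; apply: val_inj.
      by exists (inl (Ordinal ik)); congr inl; apply: val_inj.
    move=> _ ni; have ik : (i < k)%N.
      rewrite ltn_neqAle -ltnS ltn_ord andbT; apply: contra ni => /eqP ik.
      by apply/eqP; congr inr; apply: val_inj.
    by exists (inr (Ordinal ik)); congr inr; apply: val_inj.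
  have : w \in cover (blocks d) by rewrite cov.
  case/bigcupP=> B Bd wB; apply/bigcupP; exists (@widen_vertex k @: B).
    by rewrite setU1r // imset_f.
  by rewrite imset_f.
- have disj B : [disjoint last_block k & @widen_vertex k @: B].
    rewrite disjoint_sym disjoint_subset; apply/subsetP => _ /imsetP[w _ ->].
    by rewrite inE; apply: widen_vertexN.
  apply/trivIsetP => B1 B2 /setU1P[->|/imsetP[C1 C1d ->]].
    by case/setU1P=> [->|/imsetP[C2 _ ->] _]; rewrite ?eqxx.
  case/setU1P=> [-> _|/imsetP[C2 C2d ->] C12]; first by rewrite disjoint_sym.
  have nC : C1 != C2 by apply: contra C12 => /eqP ->.
  have := trivIsetP tri _ _ C1d C2d nC.
  by rewrite -!setI_eq0 -imsetI ?imset_eq0 // => x y _ _; apply: widen_vertex_inj.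
- apply/setU1P => -[/setP/(_ (inl ord_max))|].
    by rewrite !inE eqxx.
  case/imsetP=> B Bd /esym/eqP; rewrite imset_eq0 => /eqP B0.
  by rewrite -B0 Bd in n0.
Qed.

Definition embed k (d : diagram k) : diagram k.+1 := Diagram (embed_subproof d).

(** * Classes of diagrams *)

(* [pos] is the position of the elements along a line. *)
Definition noncrossing (T : finType) (pos : T -> nat) (X Y : {set T}) : bool :=
  ~~ [exists a in X, exists b in X, exists c in Y, exists d in Y,
        [&& pos a < pos c, pos c < pos b & pos b < pos d]%N
        || [&& pos c < pos a, pos a < pos d & pos d < pos b]%N].

(* Going once around the boundary of the rectangle, the vertices come in the
   order 1, ..., k, k-bar, ..., 1-bar. *)
Definition boundary_pos k (v : vertex k) : nat :=
  match v with inl i => i | inr i => (2 * k - i.+1)%N end.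

Definition planar_diagram k (d : diagram k) : bool :=
  [forall B in blocks d, forall B' in blocks d,
     (B != B') ==> noncrossing (@boundary_pos k) B B'].

Definition matching_diagram k (d : diagram k) : bool :=
  [forall B in blocks d, #|B| <= 2]%N.

Definition perfect_matching_diagram k (d : diagram k) : bool :=
  [forall B in blocks d, #|B| == 2%N].

Definition partial_permutation_diagram k (d : diagram k) : bool :=
  matching_diagram d &&
  [forall B in blocks d, (#|B| == 2%N) ==>
     [exists i : 'I_k, inl i \in B] && [exists i : 'I_k, inr i \in B]].

Definition permutation_diagram k (d : diagram k) : bool :=
  perfect_matching_diagram d && partial_permutation_diagram d.

Definition family_diagram (A : alg_family) k (d : diagram k) : bool :=
  match A with
  | Partition       => true
  | Symmetric       => permutation_diagram d
  | Brauer          => perfect_matching_diagram d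
  | Rook            => partial_permutation_diagram d
  | RookBrauer      => matching_diagram d
  | TemperleyLieb   => planar_diagram d && perfect_matching_diagram d
  | Motzkin         => planar_diagram d && matching_diagram d
  | PlanarRook      => planar_diagram d && partial_permutation_diagram d
  | PlanarPartition => planar_diagram d
  end.

(** * The partition algebra over a field and its diagram subalgebras *)

(* Formal linear combinations of diagrams. *)
Definition palg (K : fieldType) (k : nat) : vectType K := {ffun diagram k -> K^o}.

Definition basis_diagram (K : fieldType) k (d : diagram k) : palg K k :=
  [ffun d' => (d' == d)%:R].

Definition palg_one (K : fieldType) k : palg K k :=
  basis_diagram K (id_diagram k).

Definition palg_mul (K : fieldType) (n k : nat) (x y : palg K k) : palg K k :=
  \sum_(d1 : diagram k) \sum_(d2 : diagram k)
    (x d1 * y d2 * n%:R ^+ num_deleted d1 d2) *: basis_diagram K (compose d1 d2).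

Definition palg_embed (K : fieldType) k (x : palg K k) : palg K k.+1 :=
  \sum_(d : diagram k) x d *: basis_diagram K (embed d).

Definition family_alg (A : alg_family) (K : fieldType) (k : nat) :
    {vspace palg K k} :=
  <<[seq basis_diagram K d | d <- enum (@family_diagram A k)]>>%VS.

(** * Representations of the algebras [family_alg A K k] *)

(* The action only matters on the elements of the subalgebra [family_alg A K k]
   under consideration. *)
Record diag_rep (K : fieldType) (k : nat) := DiagRep {
  rep_space :> vectType K;
  rep_act : palg K k -> 'End(rep_space) }.

Arguments rep_act {K k} _ _.

Definition is_representation (A : alg_family) (n : nat) K k
    (W : diag_rep K k) : Prop :=
  [/\ forall (a : K) (x y : palg K k),
        x \in family_alg A K k -> y \in family_alg A K k ->
        rep_act W (a *: x + y) = a *: rep_act W x + rep_act W y,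
      forall x y : palg K k,
        x \in family_alg A K k -> y \in family_alg A K k ->
        rep_act W (palg_mul n x y) = (rep_act W x \o rep_act W y)%VF
    & rep_act W (palg_one K k) = \1%VF].

Definition is_irreducible (A : alg_family) (n : nat) K k
    (W : diag_rep K k) : Prop :=
  [/\ is_representation A n W,
      \dim {:W} != 0%N
    & forall U : {vspace W},
        (forall x, x \in family_alg A K k -> (rep_act W x @: U <= U)%VS) ->
        U = 0%VS \/ U = fullv].

Definition is_rep_hom (A : alg_family) K k (W W' : diag_rep K k)
    (f : 'Hom(W, W')) : Prop :=
  forall x (v : W), x \in family_alg A K k -> f (rep_act W x v) = rep_act W' x (f v).

Definition rep_iso (A : alg_family) K k (W W' : diag_rep K k) : Prop :=
  exists f : 'Hom(W, W'),
    [/\ is_rep_hom A f, lker f == 0%VS & limg f = fullv].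

Definition restrict K k (W : diag_rep K k.+1) : diag_rep K k :=
  DiagRep (fun x => rep_act W (palg_embed x)).

(* [W] is the internal direct sum of subrepresentations isomorphic to the [U i] *)
Definition is_direct_sum (A : alg_family) K k (W : diag_rep K k)
    (I : finType) (U : I -> diag_rep K k) : Prop :=
  exists f : forall i, 'Hom(U i, W),
    [/\ forall i, is_rep_hom A (f i) /\ lker (f i) == 0%VS,
        directv (\sum_i limg (f i))
      & (\sum_i limg (f i))%VS = fullv].

(** * The irreducible representations and their indexing *)

Definition irr_index (A : alg_family) (k : nat) (nu : seq nat) : bool :=
  is_part nu &&
  match A with
  | Partition | Rook | RookBrauer => (sumn nu <= k)%N
  | Symmetric => sumn nu == k
  | Brauer => (sumn nu <= k)%N && ~~ odd (k - sumn nu)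
  | TemperleyLieb =>
      [&& size nu <= 1, sumn nu <= k & ~~ odd (k - sumn nu)]%N
  | Motzkin | PlanarRook | PlanarPartition =>
      (size nu <= 1)%N && (sumn nu <= k)%N
  end.

Definition branching_mult (A : alg_family) (nu nu' : seq nat) : nat :=
  match A with
  | Partition | PlanarPartition =>
      count (fun rho => adds_at_most_one_cell rho nu') (removals nu)
  | Symmetric => adds_cell nu' nu
  | Brauer | TemperleyLieb => adds_cell nu nu' || adds_cell nu' nu
  | Rook | PlanarRook => adds_at_most_one_cell nu' nu
  | RookBrauer | Motzkin =>
      [|| nu' == nu, adds_cell nu nu' | adds_cell nu' nu]
  end.

(* For all j <= k, the [V j nu], with [nu] in the index set, form a complete
   list of the irreducible representations of the algebra [A_j] with parameter
   [n], without repetition, and the indexing is the standard one, determined by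
   the restriction rules: [s] lists the irreducible constituents of the
   restriction of [V j.+1 nu], with multiplicity. *)
Definition standard_irreps (A : alg_family) (K : fieldType) (n k : nat)
    (V : forall j : nat, seq nat -> diag_rep K j) : Prop :=
  [/\ forall j nu, (j <= k)%N -> irr_index A j nu -> is_irreducible A n (V j nu),
      forall j nu mu, (j <= k)%N -> irr_index A j nu -> irr_index A j mu ->
        rep_iso A (V j nu) (V j mu) -> nu = mu,
      forall j (W : diag_rep K j), (j <= k)%N -> is_irreducible A n W ->
        exists2 nu, irr_index A j nu & rep_iso A W (V j nu)
    & forall j nu, (j < k)%N -> irr_index A j.+1 nu ->
        exists2 s : seq (seq nat),
          forall nu', count_mem nu' s =
            (if irr_index A j nu' then branching_mult A nu nu' else 0%N)
        & is_direct_sum A (restrict (V j.+1 nu))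
            (fun i : 'I_(size s) => V j (nth [::] s i))].

(** * Standard multiset tableaux *)

(* The cell in row [cell_row c] and column [cell_col c] of the diagram of [la],
   both numbered from 0. *)
Definition cell (la : seq nat) : finType :=
  {i : 'I_(size la) & 'I_(nth 0%N la i)}.

Definition cell_row (la : seq nat) (c : cell la) : nat := tag c.
Definition cell_col (la : seq nat) (c : cell la) : nat := tagged c.

Definition filling (k : nat) (la : seq nat) : finType :=
  {ffun cell la -> {set 'I_k}}.

(* Letters are shifted by one, so that the empty set gets the value 0 and is
   smaller than every non-empty set. *)
Definition last_letter k (X : {set 'I_k}) : nat := \max_(x in X) x.+1.

Definition llt k (X Y : {set 'I_k}) : bool := (last_letter X < last_letter Y)%N.
Definition lle k (X Y : {set 'I_k}) : bool := (X == Y) || llt X Y.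

Definition standard_multiset_tableau k la (T : filling k la) : bool :=
  [&& [forall x : 'I_k, #|[set c | x \in T c]| == 1%N],
      [forall c, forall c',
         (cell_row c == cell_row c') && (cell_col c < cell_col c')%N ==>
           lle (T c) (T c')]
    & [forall c, forall c',
         (cell_col c == cell_col c') && (cell_row c' == (cell_row c).+1) ==>
           llt (T c) (T c')]].

Definition matching_tableau k la (T : filling k la) : bool :=
  [forall c, if cell_row c == 0%N then (#|T c| <= 2)%N else #|T c| == 1%N].

Definition between k (c : 'I_k) (X : {set 'I_k}) : bool :=
  [exists a in X, exists b in X, (a < c < b)%N].

Definition planar_tableau k la (T : filling k la) : bool :=
  [&& (size la <= 2)%N,
      [forall c, forall c',
         [&& cell_row c == 0%N, cell_row c' == 0%N & c != c'] ==>
         noncrossing (@nat_of_ord k) (T c) (T c')]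
    & [forall c, forall c', (cell_row c == 1%N) && (c != c') ==>
         [forall x in T c, ~~ between x (T c')]]].

Definition first_row_sizes (p : seq nat) k la (T : filling k la) : bool :=
  [forall c, (cell_row c == 0%N) ==> (#|T c| \in p)].

Definition family_tableau (A : alg_family) k la (T : filling k la) : bool :=
  match A with
  | Partition => true
  | PlanarPartition => planar_tableau T
  | Symmetric => matching_tableau T && first_row_sizes [:: 0] T
  | Brauer => matching_tableau T && first_row_sizes [:: 0; 2] T
  | Rook => matching_tableau T && first_row_sizes [:: 0; 1] T
  | RookBrauer => matching_tableau T && first_row_sizes [:: 0; 1; 2] T
  | TemperleyLieb =>
      [&& matching_tableau T, planar_tableau T & first_row_sizes [:: 0; 2] T]
  | Motzkin =>
      [&& matching_tableau T, planar_tableau T & first_row_sizes [:: 0; 1; 2] T]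
  | PlanarRook =>
      [&& matching_tableau T, planar_tableau T & first_row_sizes [:: 0; 1] T]
  end%N.

Definition SMT (A : alg_family) (k : nat) (la : seq nat) : {set filling k la} :=
  [set T | standard_multiset_tableau T && family_tableau A T].

(* Main.v *)
Require Import Defs.
From mathcomp Require Import all_boot all_order all_algebra.
From mathcomp Require Import reals complex.
From mathcomp Require Import zify.
Set Implicit Arguments. Unset Strict Implicit. Unset Printing Implicit Defensive.

(** Why the theorem is true. Both sides are equal to a product of two numbers:
    the number of partitions of [{1, ..., k}] into free and marked blocks, with
    [m = |nu|] marked blocks and with conditions on the blocks that depend on
    the family, times the number of standard Young tableaux of shape [nu],
    where [nu] is [la] without its first row.

    Tableaux. The first row of a tableau contributes the free blocks and its
    other rows the marked ones. The first row is determined by its set of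
    non-empty entries, as it is sorted by last letters, and the hypothesis
    [2 * k <= n] makes it so long that all its cells above the second row are
    empty, so that it does not constrain the rows below. The lower rows form a
    filling of [nu] by the marked blocks that is increasing for the last letter
    order, that is, a linear extension of the poset of cells of [nu]. This is
    [card_SMT], and [card_lin_ext_young_diagram] identifies the number of these
    fillings for a fixed set of blocks.

    Partitions. Deleting the largest letter [j] gives a recursion
    ([card_marked_partitions_rec]). Either [{j}] is a marked block, or it is a
    free block, or [j] is added to a block [B]. In the last case [B] is made
    marked, and the partition of the smaller set is remembered together with
    its distinguished marked block [B], whatever the status of the block of [j]
    was. In a planar family [B] has to be the rightmost marked block, since no
    marked block is allowed under another block, so there is at most one choice
    for it; otherwise any of the marked blocks can be chosen.

    Dimensions. [A_0] is one-dimensional, so the restriction rules determine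
    all dimensions, and it is enough to see that the product satisfies them
    ([dim_irreducible]). With the identities of Young's lattice, that the
    numbers of tableaux of the shapes below [nu] sum to that of [nu]
    ([sum_down_nsyt]) and those of the shapes above it to [|nu| + 1] times that
    of [nu] ([sum_up_nsyt]), the restriction rules become the recursion found
    for partitions ([sum_constituents]). *)

(** * Young's lattice *)

(** Rows past the first new one are not addable: there both compared parts are
    0. *)
Definition addable (nu : seq nat) i : bool :=
  (i == 0) || (nth 0 nu i < nth 0 nu i.-1).

Definition removable (nu : seq nat) i : bool := nth 0 nu i.+1 < nth 0 nu i.

Definition decr_row (nu : seq nat) i : seq nat :=
  [seq x <- set_nth 0 nu i (nth 0 nu i).-1 | x != 0].

Definition up (nu : seq nat) : seq (seq nat) :=
  [seq incr_nth nu i | i <- iota 0 (size nu).+1 & addable nu i].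

Definition down (nu : seq nat) : seq (seq nat) :=
  [seq decr_row nu i | i <- iota 0 (size nu) & removable nu i].

Lemma is_partP la : reflect ((forall i, nth 0 la i.+1 <= nth 0 la i) /\
  (forall i, i < size la -> 0 < nth 0 la i)) (is_part la).
Proof.
apply: (iffP andP) => [[so n0]|[H1 H2]]; split.
- move=> i; case: (ltnP i.+1 (size la)) => h; last by rewrite nth_default.
  by move/(sortedP 0): so; apply.
- by move=> i h; rewrite lt0n; apply: contraNneq n0 => <-; apply: mem_nth.
- by apply/(sortedP 0) => i _; apply: H1.
- by apply/(nthP 0) => -[i h e]; have := H2 _ h; rewrite e.
Qed.

(** As parts are positive, reading them with default 0 loses nothing; equalities
    between partitions are proved row by row. *)
Lemma part_ext la mu :
  is_part la -> is_part mu -> nth 0 la =1 nth 0 mu -> la = mu.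
Proof.
move=> /is_partP[_ pl] /is_partP[_ pm] e.
apply: (@eq_from_nth _ 0) => [|i _]; last exact: e.
case: (ltngtP (size la) (size mu)) => // h.
  by have := pm _ h; rewrite -e nth_default.
by have := pl _ h; rewrite e nth_default.
Qed.

Lemma is_part_incr nu i : is_part nu -> i <= size nu ->
  is_part (incr_nth nu i) = addable nu i.
Proof.
move=> /is_partP[H1 H2] ile; apply/is_partP/idP => [[H3 _]|].
  rewrite /addable; case: i ile H3 => // i ile /(_ i).
  by rewrite !nth_incr_nth eqxx gtn_eqF.
move=> a; split=> [j|j].
  rewrite !nth_incr_nth; have := H1 j; move: a; rewrite /addable.
  by case: (i =P j.+1) => [->|_]; case: (i =P j) => [?|_] /=; lia.
rewrite size_incr_nth nth_incr_nth; case: (i =P j) => // ne hj; apply: H2.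
by move: hj; case: ifP => //; lia.
Qed.

Lemma decr_rowK mu i : is_part mu -> i <= size mu ->
  decr_row (incr_nth mu i) i = mu.
Proof.
move=> pm ile; rewrite /decr_row nth_incr_nth eqxx /=.
have fm : [seq x <- mu | x != 0] = mu.
  apply/all_filterP; apply/allP => x xm.
  by case/andP: pm => _; apply: contraNneq => <-.
move: ile; rewrite leq_eqVlt => /orP[/eqP ->|lt].
  suff -> : set_nth 0 (incr_nth mu (size mu)) (size mu) (nth 0 mu (size mu)) = rcons mu 0.
    by rewrite filter_rcons /= fm.
  apply: (@eq_from_nth _ 0).
    by rewrite size_set_nth size_incr_nth ltnn size_rcons; lia.
  move=> j _; rewrite nth_set_nth /= nth_incr_nth nth_rcons.
  case: eqP => [->|/eqP ne]; first by rewrite ltnn nth_default.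
  by rewrite eq_sym (negbTE ne); case: ltnP => // h; rewrite nth_default.
rewrite -[RHS]fm; congr filter.
apply: (@eq_from_nth _ 0).
  by rewrite size_set_nth size_incr_nth lt; lia.
move=> j _; rewrite nth_set_nth /= nth_incr_nth.
by case: eqP => [->|/eqP ne] //; rewrite eq_sym (negbTE ne).
Qed.

Lemma removable_lt nu i : removable nu i -> i < size nu.
Proof. by rewrite /removable; case: (ltnP i (size nu)) => // h; rewrite (nth_default _ h). Qed.

Lemma addable_le nu i : addable nu i -> i <= size nu.
Proof.
by case: i => // i; rewrite /addable /=; case: (ltnP i (size nu)) => // h; rewrite (nth_default _ h).
Qed.

(** All statements on the removal of a cell are reduced to the addition of one,
    which is easier to compute with because no part disappears. *)
Lemma removable_incr nu i : is_part nu -> removable nu i ->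
  exists mu, [/\ is_part mu, i <= size mu & nu = incr_nth mu i].
Proof.
move=> /is_partP[H1 H2] r; have lt := removable_lt r.
(* A part equal to 1 that can be decreased is the last one, and disappears. *)
have [e1|n1] := eqVneq (nth 0 nu i) 1.
  have sz : size nu = i.+1.
    apply/eqP; rewrite eqn_leq lt andbT leqNgt; apply/negP => /H2.
    by move: r; rewrite /removable e1; lia.
  exists (take i nu).
  have szt : size (take i nu) = i by rewrite size_take lt.
  split; [|by rewrite szt|].
    apply/is_partP; split => j; rewrite ?szt => *.
      case: (ltnP j.+1 i) => h; last by rewrite nth_default ?szt.
      by rewrite !nth_take ?(ltnW h).
    by rewrite nth_take // H2 // sz; lia.
  apply: (@eq_from_nth _ 0); first by rewrite size_incr_nth szt ltnn.
  move=> j; rewrite sz ltnS leq_eqVlt nth_incr_nth => /orP[/eqP ->|h].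
    by rewrite e1 eqxx nth_default ?szt.
  by rewrite nth_take // gtn_eqF.
exists (set_nth 0 nu i (nth 0 nu i).-1).
have szs : size (set_nth 0 nu i (nth 0 nu i).-1) = size nu.
  by rewrite size_set_nth; lia.
split.
- apply/is_partP; split => j.
    rewrite !nth_set_nth /=; have := H1 j; move: r; rewrite /removable.
    by case: eqP => [->|_]; case: eqP => [->|_]; lia.
  rewrite szs nth_set_nth /= => /H2; case: eqP => // -> _.
  by have := H2 _ lt; lia.
- by rewrite szs ltnW.
apply: (@eq_from_nth _ 0); first by rewrite size_incr_nth szs lt.
move=> j _; rewrite nth_incr_nth nth_set_nth /= eq_sym.
by case: eqP => [->|] //; have := H2 _ lt; lia.
Qed.

Lemma decr_rowP nu i : is_part nu -> removable nu i ->
  [/\ is_part (decr_row nu i), i <= size (decr_row nu i)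
    & incr_nth (decr_row nu i) i = nu].
Proof.
by move=> pn r; have [mu [pm im ->]] := removable_incr pn r; rewrite decr_rowK.
Qed.

Lemma nth_decr_row nu i j : is_part nu -> removable nu i ->
  nth 0 (decr_row nu i) j = nth 0 nu j - (i == j).
Proof.
move=> pn r; have [_ _ {2}<-] := decr_rowP pn r.
by rewrite nth_incr_nth addKn.
Qed.

Lemma removable_incr_nth mu i : is_part mu -> is_part (incr_nth mu i) ->
  removable (incr_nth mu i) i.
Proof.
move=> /is_partP[H _] _; rewrite /removable !nth_incr_nth eqxx ltn_eqF //.
by rewrite add0n add1n ltnS.
Qed.

Lemma mem_up nu x : is_part nu -> (x \in up nu) = is_part x && adds_cell nu x.
Proof.
move=> pn; apply/mapP/andP => [[ i ]|[px /hasP[ i ]]].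
  rewrite mem_filter => /andP[a im] ->; split.
    by rewrite is_part_incr // addable_le.
  by apply/hasP; exists i.
move=> im /eqP e; exists i => //; rewrite mem_filter im andbT.
by rewrite -is_part_incr -?e //; move: im; rewrite mem_iota; lia.
Qed.

Lemma mem_down nu x : is_part nu -> (x \in down nu) = is_part x && adds_cell x nu.
Proof.
move=> pn; apply/mapP/andP => [[ i ]|[px /hasP[ i ]]].
  rewrite mem_filter => /andP[r im] ->.
  have [pd sd e] := decr_rowP pn r; split => //.
  by apply/hasP; exists i; rewrite ?mem_iota ?e //=; lia.
rewrite mem_iota add0n => /andP[_ im] /eqP e; exists i.
  rewrite mem_filter mem_iota /= add0n {1 2}e.
  rewrite removable_incr_nth -?e //= e size_incr_nth.
  by case: ifP => // ->.
by rewrite e decr_rowK.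
Qed.

Lemma up_uniq nu : uniq (up nu).
Proof.
by rewrite map_inj_uniq ?filter_uniq ?iota_uniq //; apply: incr_nth_inj.
Qed.

Lemma down_uniq nu : is_part nu -> uniq (down nu).
Proof.
move=> pn; rewrite map_inj_in_uniq ?filter_uniq ?iota_uniq //.
move=> i j; rewrite !mem_filter => /andP[ri _] /andP[rj _] e.
have := nth_decr_row i pn ri; rewrite e (nth_decr_row _ pn rj) eqxx.
by case: eqP => // _; move: ri; rewrite /removable; lia.
Qed.

Lemma sumn_incr_nth nu i : sumn (incr_nth nu i) = (sumn nu).+1.
Proof.
elim: nu i => [|x nu IH] [|i] //=; last by rewrite IH addnS.
by rewrite sumn_ncons mul0n.
Qed.

Lemma sumn_up nu x : x \in up nu -> sumn x = (sumn nu).+1.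
Proof. by case/mapP => i _ ->; rewrite sumn_incr_nth. Qed.

Lemma sumn_down nu x : is_part nu -> x \in down nu -> sumn nu = (sumn x).+1.
Proof.
move=> pn; case/mapP => i; rewrite mem_filter => /andP[r _] ->.
by have [_ _ {1}<-] := decr_rowP pn r; rewrite sumn_incr_nth.
Qed.

Lemma removalsE nu : is_part nu -> perm_eq (removals nu) (nu :: down nu).
Proof.
move=> pn; apply: uniq_perm.
- by rewrite filter_uniq ?undup_uniq.
- rewrite /= down_uniq // andbT; apply/negP => /(sumn_down pn); lia.
move=> x; rewrite mem_filter mem_undup !inE (mem_down _ pn).
have [->|ne] := eqVneq x nu; first by rewrite pn /adds_at_most_one_cell eqxx.
rewrite /adds_at_most_one_cell eq_sym (negbTE ne) /=.
apply: andb_idr => /andP[px /hasP[ i ]].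
rewrite mem_iota add0n => /andP[_ im] /eqP e; apply/mapP; exists i.
  by rewrite mem_iota e size_incr_nth /=; case: ifP => // ->.
by rewrite -/(decr_row nu i) e decr_rowK.
Qed.

(** Row indices larger than necessary are harmless, which allows the same range
    of rows for all the partitions of a double sum. *)
Lemma sum_up_rows nu N (F : seq nat -> nat) : size nu < N ->
  \sum_(x <- up nu) F x = \sum_(i < N | addable nu i) F (incr_nth nu i).
Proof.
move=> h; rewrite big_map big_filter.
rewrite -(big_mkord (addable nu) (fun i => F (incr_nth nu i))) /index_iota subn0.
rewrite -(subnKC h) iotaD big_cat /= add0n -[LHS]addn0; congr addn.
rewrite big_seq_cond big1 // => i; rewrite mem_iota => /andP[/andP[h1 _]].
by move/addable_le; lia.
Qed.

Lemma sum_down_rows nu N (F : seq nat -> nat) : size nu <= N ->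
  \sum_(x <- down nu) F x = \sum_(i < N | removable nu i) F (decr_row nu i).
Proof.
move=> h; rewrite big_map big_filter.
rewrite -(big_mkord (removable nu) (fun i => F (decr_row nu i))) /index_iota subn0.
rewrite -(subnKC h) iotaD big_cat /= add0n -[LHS]addn0; congr addn.
rewrite big_seq_cond big1 // => i; rewrite mem_iota => /andP[/andP[h1 _]].
by move/removable_lt; lia.
Qed.

(** Row [i] can lose a cell exactly when row [i.+1] can gain one, and row 0 can
    always gain one. *)
Lemma card_addable_removable nu N : is_part nu -> size nu < N ->
  \sum_(i < N | addable nu i) 1 = (\sum_(i < N | removable nu i) 1).+1.
Proof.
move=> pn h; case: N h => // N h.
rewrite big_mkcond big_ord_recl [in RHS]big_mkcond big_ord_recr /=.
have -> : removable nu N = false.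
  by apply/negP => /removable_lt; lia.
by rewrite addn0 add1n.
Qed.

Lemma part_up nu x : is_part nu -> x \in up nu -> is_part x.
Proof. by move=> pn; rewrite mem_up // => /andP[]. Qed.

Lemma part_down nu x : is_part nu -> x \in down nu -> is_part x.
Proof. by move=> pn; rewrite mem_down // => /andP[]. Qed.

(** The two rows interact only if [i = j.+1]; then both sides say that row [j]
    is at least two cells longer than row [i]. *)
Lemma addable_removable_comm nu i j : is_part nu -> i != j ->
  addable nu i && removable (incr_nth nu i) j =
  removable nu j && addable (decr_row nu j) i.
Proof.
move=> pn ij; case r: (removable nu j).
  rewrite /= /addable !(nth_decr_row _ pn r) (eq_sym j) (negbTE ij) subn0.
  move: r; rewrite /removable !nth_incr_nth (negbTE ij) add0n.
  case: i ij => [|i] ij /=; rewrite ?add0n // eqSS.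
  by case: (i =P j) => [->|/eqP ne]; rewrite ?eqxx ?(eq_sym j) ?(negbTE ne) /=; lia.
rewrite /=; apply/negP => /andP[_]; move: r; rewrite /removable !nth_incr_nth (negbTE ij).
lia.
Qed.

Lemma decr_incr_comm nu i j : is_part nu -> i != j ->
    addable nu i && removable (incr_nth nu i) j ->
  decr_row (incr_nth nu i) j = incr_nth (decr_row nu j) i.
Proof.
move=> pn ij H; have := H; rewrite addable_removable_comm // => /andP[r' a'].
case/andP: H => a r; have [pd _ _] := decr_rowP pn r'.
have pi : is_part (incr_nth nu i) by rewrite is_part_incr ?addable_le.
have [pdi _ _] := decr_rowP pi r.
apply: part_ext => // [|x]; first by rewrite is_part_incr ?addable_le.
rewrite nth_decr_row // !nth_incr_nth nth_decr_row //.
have := r'; rewrite /removable.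
case: (i =P x) ij => [->|_]; case: (j =P x) => [->|_] //=; lia.
Qed.

(** Young's lattice is a differential poset: adding then removing a cell and
    removing then adding one differ only by the identity. The two orders
    correspond bijectively for distinct rows, and for equal rows there is
    one more addable row than removable ones. *)
Lemma up_down_commute nu (F : seq nat -> nat) : is_part nu ->
  \sum_(x <- up nu) \sum_(y <- down x) F y =
  F nu + \sum_(x <- down nu) \sum_(y <- up x) F y.
Proof.
move=> pn; pose N := (size nu).+2.
pose G i j := if addable nu i && removable (incr_nth nu i) j
  then F (decr_row (incr_nth nu i) j) else 0.
pose G' i j := if removable nu j && addable (decr_row nu j) i
  then F (incr_nth (decr_row nu j) i) else 0.
have -> : \sum_(x <- up nu) \sum_(y <- down x) F y =
    \sum_(i < N) \sum_(j < N) G i j.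
  rewrite (@sum_up_rows _ N) // big_mkcond; apply: eq_bigr => i _; rewrite /G.
  case: ifP => a; last by rewrite big1.
  rewrite (@sum_down_rows _ N) ?[LHS]big_mkcond // size_incr_nth.
  by have := addable_le a; case: ifP => // _; rewrite /N; lia.
have -> : \sum_(x <- down nu) \sum_(y <- up x) F y =
    \sum_(i < N) \sum_(j < N) G' i j.
  rewrite exchange_big (@sum_down_rows _ N) ?/N; last by rewrite 2?leqW.
  rewrite big_mkcond; apply: eq_bigr => j _; rewrite /G'.
  case: ifP => r; last by rewrite big1.
  rewrite (@sum_up_rows _ N) ?[LHS]big_mkcond //.
  have [_ _ e] := decr_rowP pn r; move: (congr1 size e); rewrite size_incr_nth.
  by rewrite /N; case: ifP; lia.
(* Off the diagonal the two double sums agree term by term; on it they are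
   multiples of [F nu], by the numbers of addable and of removable rows. *)
have GG' (i j : 'I_N) : i != j -> G i j = G' i j.
  move=> ij; rewrite /G /G' -addable_removable_comm //.
  by case: ifP => // H; rewrite decr_incr_comm.
have Gd (i : 'I_N) : G i i = if addable nu i then F nu else 0.
  rewrite /G; case: ifP => a; have := a.
    by case/andP=> -> _; rewrite decr_rowK // addable_le //; case/andP: a.
  case: ifP => // a' /=; rewrite removable_incr_nth // is_part_incr //.
  exact: addable_le.
have G'd (i : 'I_N) : G' i i = if removable nu i then F nu else 0.
  rewrite /G'; case: ifP => [/andP[r a]|].
    by rewrite r; have [_ _ ->] := decr_rowP pn r.
  case: ifP => // r /=; have [pd sd e] := decr_rowP pn r.
  by rewrite -is_part_incr // e pn.
have split (H : nat -> nat -> nat) : \sum_(i < N) \sum_(j < N) H i j =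
    \sum_(i < N) H i i + \sum_(i < N) \sum_(j < N | j != i) H i j.
  by rewrite -big_split; apply: eq_bigr => i _; rewrite (bigD1 i).
rewrite !split addnA; congr addn; last first.
  by apply: eq_bigr => i _; apply: eq_bigr => j ji; rewrite GG' // eq_sym.
rewrite (eq_bigr _ (fun i _ => Gd i)) (eq_bigr _ (fun i _ => G'd i)) -!big_mkcond /=.
rewrite !sum_nat_const -mulSn; congr muln.
by rewrite -!sum1_card card_addable_removable.
Qed.

(** Chains of [m] removals starting at [nu]. They end at the empty partition
    when [m] is the size of [nu]; reading such a chain backwards gives a
    standard Young tableau. *)
Fixpoint removal_chains (m : nat) (nu : seq nat) : nat :=
  if m is m'.+1 then \sum_(x <- down nu) removal_chains m' x else 1.

Definition nsyt (nu : seq nat) : nat := removal_chains (sumn nu) nu.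

Lemma sumn_eq0 nu : is_part nu -> (sumn nu == 0) = (nu == [::]).
Proof.
by case: nu => // x nu /is_partP[_ /(_ 0 isT)] /=; rewrite addn_eq0; case: x.
Qed.

Lemma sum_down_nsyt nu : is_part nu -> nu != [::] ->
  \sum_(x <- down nu) nsyt x = nsyt nu.
Proof.
move=> pn; rewrite -sumn_eq0 // /nsyt; case e: (sumn nu) => [//|m] _ /=.
by rewrite !big_seq; apply: eq_bigr => x /(sumn_down pn); rewrite e => -[->].
Qed.

(** This follows from [up_down_commute] by induction on the size: the extra term
    contributes one copy of the number of tableaux of [nu], and the
    induction hypothesis contributes [|nu|] copies. *)
Lemma sum_up_nsyt nu : is_part nu ->
  \sum_(x <- up nu) nsyt x = (sumn nu).+1 * nsyt nu.
Proof.
move e: (sumn nu) => m; elim: m nu e => [|m IH] nu e pn.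
  have := sumn_eq0 pn; rewrite e eqxx => /esym/eqP ->.
  by rewrite big_seq1 /nsyt /= /down /= big_seq1.
have -> : \sum_(x <- up nu) nsyt x = \sum_(x <- up nu) \sum_(y <- down x) nsyt y.
  rewrite !big_seq; apply: eq_bigr => x xu; rewrite sum_down_nsyt ?(part_up pn) //.
  by apply: contra_eqN (sumn_up xu) => /eqP ->.
rewrite up_down_commute // mulSn; congr addn.
rewrite -[in RHS]sum_down_nsyt // -?sumn_eq0 ?e //.
rewrite big_distrr /= !big_seq; apply: eq_bigr => x xd; apply: IH.
  by have := sumn_down pn xd; rewrite e => -[].
exact: part_down xd.
Qed.

(** * The dimension recursion *)

Definition planar_family A : bool :=
  match A with
  | TemperleyLieb | Motzkin | PlanarRook | PlanarPartition => true
  | _ => false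
  end.

Definition allows_singletons A : bool :=
  match A with Symmetric | Brauer | TemperleyLieb => false | _ => true end.

Definition allows_pairs A : bool :=
  match A with Symmetric | Rook | PlanarRook => false | _ => true end.

Definition allows_large A : bool :=
  match A with Partition | PlanarPartition => true | _ => false end.

(** The number of marked blocks, out of [m], to which a new letter can be added. *)
Definition choices A m : nat := if planar_family A then (0 < m : nat) else m.

(** The number of admissible partitions of [j] letters with [m] marked blocks,
    as computed by the deletion of the largest letter; see
    [card_marked_partitions]. The summands stand for a marked singleton, a
    free singleton, a larger marked block and a larger free block. *)
Fixpoint marked_count A j m : nat :=
  if j is j'.+1 then
    (if m is m'.+1 then marked_count A j' m' else 0)
    + (allows_singletons A + allows_large A * choices A m) * marked_count A j' m
    + allows_pairs A * choices A m.+1 * marked_count A j' m.+1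
  else m == 0.

(** In a planar family only one-row shapes occur, each with a single tableau.
    Giving value 0 to the other shapes makes up for the fact that the
    restriction rules, shared with a non-planar family, also lead from a row
    to shapes with two rows. *)
Definition shape_count A nu : nat :=
  if planar_family A then (size nu <= 1 : nat) else nsyt nu.

Lemma sum_down_shape_count A nu : is_part nu -> planar_family A ==> (size nu <= 1) ->
  \sum_(x <- down nu) shape_count A x = (nu != [::]) * shape_count A nu.
Proof.
rewrite /shape_count; case: (planar_family A) => /= [|pn _].
  case: nu => [|x [|//]] pn _; first by rewrite big_nil.
  rewrite /down /= /removable /=; case: x pn => [/andP[] //|x] _ /=.
  by rewrite big_seq1 /decr_row /=; case: x.
have [->|ne] := eqVneq nu [::]; first by rewrite big_nil.
by rewrite sum_down_nsyt // mul1n.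
Qed.

(** In the planar case [up] of a row [(m)] consists of [(m + 1)] and of [(m,
    1)], which is not counted; so the factor drops from [m + 1] to 1. *)
Lemma sum_up_shape_count A nu : is_part nu -> planar_family A ==> (size nu <= 1) ->
  \sum_(x <- up nu) shape_count A x = choices A (sumn nu).+1 * shape_count A nu.
Proof.
rewrite /shape_count /choices; case: (planar_family A) => /= [|pn _].
  case: nu => [|x [|//]] pn _; first by rewrite big_seq1.
  rewrite /up /= /addable /=; case: x pn => [/andP[] //|x] _ /=.
  by rewrite !big_cons big_nil.
exact: sum_up_nsyt.
Qed.

Lemma size_down nu x : is_part nu -> x \in down nu -> size x <= size nu.
Proof.
move=> pn; rewrite mem_down // => /andP[_ /hasP[i _ /eqP ->]].
by rewrite size_incr_nth; case: (ltnP i) => // /leqW.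
Qed.

(** The partitions given by the restriction rules, with multiplicity and before
    intersecting with the index set of the smaller algebra. *)
Definition constituents A nu : seq (seq nat) :=
  match A with
  | Partition | PlanarPartition =>
      flatten [seq rho :: up rho | rho <- nu :: down nu]
  | Symmetric => down nu
  | Brauer | TemperleyLieb => up nu ++ down nu
  | Rook | PlanarRook => nu :: down nu
  | RookBrauer | Motzkin => nu :: up nu ++ down nu
  end.

Lemma constituents_part A nu x : is_part nu -> x \in constituents A nu -> is_part x.
Proof.
move=> pn; have pd := @part_down nu x pn; have pu := @part_up nu x pn.
have pf : x \in flatten [seq rho :: up rho | rho <- nu :: down nu] -> is_part x.
  case/flatten_mapP => rho; rewrite !inE => rd.
  have pr : is_part rho by case/orP: rd => [/eqP -> //|]; apply: part_down.
  by case/orP => [/eqP -> //|]; apply: part_up.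
have pud : x \in up nu ++ down nu -> is_part x by rewrite mem_cat => /orP[].
by case: A => //; rewrite /constituents in_cons => /predU1P[->|].
Qed.

(** Sums over [up] and [down] only change the size by one, so the identities of
    Young's lattice turn the restriction rules into the recursion defining
    [marked_count]. *)
Lemma sum_constituents A j nu : is_part nu -> planar_family A ==> (size nu <= 1) ->
  \sum_(x <- constituents A nu) marked_count A j (sumn x) * shape_count A x =
  marked_count A j.+1 (sumn nu) * shape_count A nu.
Proof.
move=> pn pl.
pose F x := marked_count A j (sumn x) * shape_count A x.
pose N m := marked_count A j m; pose g := shape_count A.
have UP x : is_part x -> planar_family A ==> (size x <= 1) ->
    \sum_(y <- up x) F y = choices A (sumn x).+1 * N (sumn x).+1 * g x.
  move=> px plx; rewrite mulnAC -sum_up_shape_count // big_distrl /=.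
  by rewrite !big_seq; apply: eq_bigr => y yu; rewrite /F (sumn_up yu) mulnC.
have DOWN (h : nat -> nat) : \sum_(x <- down nu) h (sumn x) * g x =
    (if sumn nu is m'.+1 then h m' else 0) * g nu.
  have -> : \sum_(x <- down nu) h (sumn x) * g x =
      \sum_(x <- down nu) h (sumn nu).-1 * g x.
    by rewrite !big_seq; apply: eq_bigr => y /(sumn_down pn) ->.
  rewrite -big_distrr sum_down_shape_count //= -sumn_eq0 // -/g.
  by case: (sumn nu) => [|m]; rewrite ?mul0n ?muln0 ?mul1n.
have PART : \sum_(x <- flatten [seq rho :: up rho | rho <- nu :: down nu]) F x =
    ((if sumn nu is m'.+1 then N m' else 0) + (1 + choices A (sumn nu)) * N (sumn nu)
      + choices A (sumn nu).+1 * N (sumn nu).+1) * g nu.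
  rewrite big_flatten big_map big_cons big_cons UP //.
  have -> : \sum_(x <- down nu) \sum_(y <- x :: up x) F y =
     \sum_(x <- down nu) (N (sumn x) + choices A (sumn x).+1 * N (sumn x).+1) * g x.
    rewrite !big_seq; apply: eq_bigr => x xd; rewrite big_cons UP ?(part_down pn) //.
      by rewrite mulnDl.
    apply: contraTT pl; rewrite !negb_imply -!ltnNge => /andP[-> /=].
    by move/leq_trans; apply; apply: size_down.
  rewrite (DOWN (fun m => N m + choices A m.+1 * N m.+1)) /F -/(N _) -/g.
  rewrite /= !mulnDl ?mul0n ?mul1n; case: (sumn nu) => [|m]; last by rewrite !mulnDl; lia.
  have -> : choices A 0 = 0 by rewrite /choices; case: ifP.
  by rewrite !mul0n; lia.
have D : \sum_(x <- down nu) F x = (if sumn nu is m'.+1 then N m' else 0) * g nu.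
  exact: (DOWN N).
have Fnu : F nu = N (sumn nu) * g nu by [].
have U := UP _ pn pl.
pose n1 := if sumn nu is m'.+1 then N m' else 0.
have -> : marked_count A j.+1 (sumn nu) = n1
    + (allows_singletons A + allows_large A * choices A (sumn nu)) * N (sumn nu)
    + allows_pairs A * choices A (sumn nu).+1 * N (sumn nu).+1 by [].
rewrite (eq_bigr F) // -/g.
have F1 s : \sum_(x <- nu :: s) F x = F nu + \sum_(x <- s) F x by rewrite big_cons.
have FC : \sum_(x <- up nu ++ down nu) F x = \sum_(x <- up nu) F x + \sum_(x <- down nu) F x.
  by rewrite big_cat.
move: FC U D F1 Fnu PART; rewrite -/n1; clearbody N g F n1; clear UP DOWN.
move: n1 (choices A (sumn nu)) (choices A _.+1) => n1 w w'.
move: (N (sumn nu)) (N _.+1) (g nu) (F nu) => N0 N1 g0 F0.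
by case: A pl; rewrite /constituents => pl FC U D F1 Fnu PART;
  rewrite ?PART ?F1 ?FC ?U ?D ?Fnu /allows_singletons /allows_large /allows_pairs;
  rewrite ?[nat_of_bool _]/= ?mulnDl ?mul0n ?mul1n ?mulnDl ?mul1n; lia.
Qed.

Lemma count_mem_up nu x : is_part nu -> is_part x -> count_mem x (up nu) = adds_cell nu x.
Proof. by move=> pn px; rewrite count_uniq_mem ?up_uniq // mem_up // px. Qed.

Lemma count_mem_down nu x : is_part nu -> is_part x ->
  count_mem x (down nu) = adds_cell x nu.
Proof. by move=> pn px; rewrite count_uniq_mem ?down_uniq // mem_down // px. Qed.

Lemma adds_cell_sumn mu nu : adds_cell mu nu -> sumn nu = (sumn mu).+1.
Proof. by case/hasP => i _ /eqP ->; rewrite sumn_incr_nth. Qed.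

Lemma count_constituents A nu x : is_part nu -> is_part x ->
  count_mem x (constituents A nu) = branching_mult A nu x.
Proof.
move=> pn px.
have irr rho : adds_cell rho rho = false.
  by apply/negP => /adds_cell_sumn; lia.
have C1 rho : is_part rho ->
    count_mem x (rho :: up rho) = adds_at_most_one_cell rho x.
  move=> pr; have -> : count_mem x (rho :: up rho) = (rho == x) + count_mem x (up rho) by [].
  rewrite count_mem_up // /adds_at_most_one_cell eq_sym.
  case: eqP => //= ->; rewrite irr //.
have CD : count_mem x (nu :: down nu) = adds_at_most_one_cell x nu.
  rewrite /= count_mem_down // /adds_at_most_one_cell.
  case: eqP => //= ->; rewrite irr //.
have CP : count_mem x (flatten [seq rho :: up rho | rho <- nu :: down nu]) =
    count (fun rho => adds_at_most_one_cell rho x) (removals nu).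
  rewrite (permP (removalsE pn)) count_flatten -map_comp -sumn_count.
  congr sumn; apply/eq_in_map => rho rd.
  have pr : is_part rho.
    by move: rd; rewrite in_cons => /predU1P[-> //|]; apply: part_down.
  by rewrite [LHS]C1.
have CUD : count_mem x (up nu ++ down nu) = adds_cell nu x || adds_cell x nu.
  rewrite count_cat count_mem_up // count_mem_down //.
  case a: (adds_cell nu x); case b: (adds_cell x nu) => //.
  by have := adds_cell_sumn a; have := adds_cell_sumn b; lia.
have CNUD : count_mem x (nu :: up nu ++ down nu) =
    [|| x == nu, adds_cell nu x | adds_cell x nu].
  have -> : count_mem x (nu :: up nu ++ down nu) =
    (nu == x) + count_mem x (up nu ++ down nu) by [].
  rewrite CUD eq_sym.
  by case: eqP => //= ->; rewrite irr.
by case: A => //; rewrite [LHS]count_mem_down.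
Qed.

(** Outside the index set the product vanishes on its own: there are more marked
    blocks than letters, or the parity is wrong, or the shape has two rows
    in a planar family. *)
Lemma marked_count_vanish A j nu : is_part nu -> ~~ irr_index A j nu ->
  marked_count A j (sumn nu) * shape_count A nu = 0.
Proof.
move=> pn; rewrite /irr_index pn andTb /shape_count.
have big m : j < m -> marked_count A j m = 0.
  elim: j m => [|j IH] [|m] //= jm; rewrite !IH //; lia.
have sym m : A = Symmetric -> j != m -> marked_count A j m = 0.
  move=> ->; elim: j m {big} => [|j IH] [|m] //= jm; by rewrite IH.
have par m : A = Brauer \/ A = TemperleyLieb -> m <= j -> odd (j - m) -> marked_count A j m = 0.
  move=> AS; have so : allows_singletons A = false by case: AS => ->.
  have la : allows_large A = false by case: AS => ->.
  move=> _; elim: j m {sym} big => [//|j IH] m big o.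
  have bigj i : j < i -> marked_count A j i = 0.
    by elim: j i {IH big o} => [|j IH] [|m'] //= jm; rewrite !IH //; lia.
  have z i : odd (j - i) || (j < i) -> marked_count A j i = 0.
    by case/orP; [apply: IH | apply: bigj].
  rewrite /= so la /= ?add0n ?addn0 [marked_count A j m.+1]z ?muln0 ?addn0; last by lia.
  by case: m o {big} => // m; rewrite subSS => o; rewrite z ?o.
case: (ltnP j (sumn nu)) => [/big -> //|le].
case EA: A => /=; rewrite ?andbF ?andbT ?le //= ?andbT ?andTb.
- by move=> ne; rewrite -EA sym // eq_sym.
- by rewrite negbK => o; rewrite -EA par //; left.
- case: (size nu <= 1); rewrite ?muln0 //= negbK => o.
  by rewrite -EA par //; right.
all: by case: (size nu <= 1); rewrite ?muln0.
Qed.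

(** * Partitions with marked blocks *)

Definition free_ok A K (B : {set 'I_K}) : bool :=
  [|| allows_large A, allows_singletons A && (#|B| == 1)
    | allows_pairs A && (#|B| == 2)].

Definition marked_ok A K (B : {set 'I_K}) : bool :=
  allows_large A || (#|B| == 1).

Definition exposed K (X Y : {set 'I_K}) : bool :=
  [forall x in X, ~~ between x Y].

(** Free blocks may be nested, but a marked block is visible from above: no
    other block passes over any of its letters. *)
Definition planar_pair K (U M : {set {set 'I_K}}) : bool :=
  [forall X in U, forall Y in U, (X != Y) ==> noncrossing (@nat_of_ord K) X Y]
  && [forall X in M, forall Y in U :|: M, (Y != X) ==> exposed X Y].

Definition marked_partition A K (S : {set 'I_K}) (U M : {set {set 'I_K}}) : bool :=
  [&& partition (U :|: M) S, [disjoint U & M], [forall B in U, free_ok A B],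
      [forall B in M, marked_ok A B] & planar_family A ==> planar_pair U M].

Lemma exposedP K (X Y : {set 'I_K}) :
  reflect (forall x y z, x \in X -> y \in Y -> z \in Y -> y < x -> x < z -> False)
    (exposed X Y).
Proof.
apply: (iffP forall_inP) => [H x y z xX yY zY yx xz|H x xX].
  by have /negP := H _ xX; case; apply/exists_inP; exists y => //;
     apply/exists_inP; exists z => //; rewrite yx.
apply/negP => /exists_inP[y yY /exists_inP[z zY /andP[yx xz]]].
exact: (H x y z).
Qed.

Lemma noncrossingP K (X Y : {set 'I_K}) :
  reflect (forall a b c d, a \in X -> b \in X -> c \in Y -> d \in Y ->
     ~ [/\ a < c, c < b & b < d] /\ ~ [/\ c < a, a < d & d < b])
    (noncrossing (@nat_of_ord K) X Y).
Proof.
apply: (iffP idP) => [/negP H a b c d aX bX cY dY|H].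
  split=> -[h1 h2 h3]; case: H; apply/exists_inP; exists a => //;
  apply/exists_inP; exists b => //; apply/exists_inP; exists c => //;
  by apply/exists_inP; exists d => //; rewrite h1 h2 h3 ?orbT.
apply/negP => /exists_inP[a aX /exists_inP[b bX /exists_inP[c cY /exists_inP[d dY]]]].
have [H1 H2] := H a b c d aX bX cY dY.
by case/orP => /and3P h; [apply: H1 | apply: H2].
Qed.

Lemma noncrossing_sym K (X Y : {set 'I_K}) :
  noncrossing (@nat_of_ord K) X Y = noncrossing (@nat_of_ord K) Y X.
Proof.
suff H (P Q : {set 'I_K}) : noncrossing (@nat_of_ord K) P Q ->
    noncrossing (@nat_of_ord K) Q P by apply/idP/idP; apply: H.
move/noncrossingP => H; apply/noncrossingP => a b c d aX bX cY dY.
have [H1 H2] := H c d a b cY dY aX bX.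
by split=> h; [apply: H2 | apply: H1]; case: h.
Qed.

Lemma partition_addE (T : finType) (B S : {set T}) (P : {set {set T}}) : B \notin P ->
  partition (B |: P) S = [&& B != set0, B \subset S & partition P (S :\: B)].
Proof.
move=> BP; apply/idP/and3P => [pP|[B0 BS pP]].
  have BBP : B \in B |: P by rewrite setU11.
  split; [exact: partition_neq0 pP BBP | exact: partitionS pP BBP|].
  by have := partitionD1 pP BBP; rewrite setU1K.
rewrite -[S](setID S B) (setIidPr BS); apply: partitionU1 => //.
by rewrite disjoint_sym disjoints_subset subsetDr.
Qed.

(** What has to be checked about a new marked block [B], relative to the blocks
    already present. *)
Definition marked_fits A K (U M : {set {set 'I_K}}) (B : {set 'I_K}) : bool :=
  marked_ok A B && (planar_family A ==>
    [forall Y in U :|: M, exposed B Y] && [forall X in M, exposed X B]).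

Definition free_fits A K (U M : {set {set 'I_K}}) (B : {set 'I_K}) : bool :=
  free_ok A B && (planar_family A ==>
    [forall Y in U, noncrossing (@nat_of_ord K) B Y] && [forall X in M, exposed X B]).

Lemma forall_inU1 (T : finType) (B : T) (P : {set T}) (p : pred T) :
  [forall x in B |: P, p x] = p B && [forall x in P, p x].
Proof.
apply/forall_inP/andP => [H|[pB /forall_inP H] x /setU1P[->|]] //; last exact: H.
split; first by apply: H; rewrite setU11.
by apply/forall_inP => x xP; apply: H; rewrite setU1r.
Qed.

Lemma disjointsU1 (T : finType) (B : T) (P Q : {set T}) :
  [disjoint B |: P & Q] = (B \notin Q) && [disjoint P & Q].
Proof. by rewrite -[LHS]setI_eq0 setIUl setU_eq0 !setI_eq0 disjoints1. Qed.

(** Separating one block from the others isolates the conditions that involve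
    it, so that the change of a single block can be studied with
    [marked_fits] and [free_fits] alone. *)
Lemma marked_partition_addM A K (S B : {set 'I_K}) (U M : {set {set 'I_K}}) : B \notin U -> B \notin M ->
  marked_partition A S U (B |: M) =
  [&& B != set0, B \subset S, marked_partition A (S :\: B) U M & marked_fits A U M B].
Proof.
move=> BU BM; rewrite /marked_partition /marked_fits setUCA.
rewrite partition_addE ?inE ?negb_or ?BU // ![[disjoint U & _]]disjoint_sym disjointsU1 BU.
rewrite forall_inU1; case: (B != set0) => //=; case: (B \subset S) => //=.
case: (partition _ _) => //=; case: [disjoint _ & _] => //=.
case: [forall B0 in U, _] => //=; case: [forall B0 in M, _]; rewrite ?andbF //=.
case: (marked_ok A B); rewrite ?andbF //=; case: (planar_family A) => //=.
rewrite /planar_pair forall_inU1 -!andbA; congr andb.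
apply/andP/and3P => -[H1 H2]; last move=> H3; split.
- apply/forall_inP => X XM; apply/forall_inP => Y Y_.
  by move/forall_inP: H2 => /(_ _ XM) /forall_inP; apply; rewrite setUCA setU1r.
- apply/forall_inP => Y Y_; move/forall_inP: H1 => /(_ Y).
  rewrite setUCA setU1r // => /(_ isT) /implyP; apply.
  by apply: contraTneq Y_ => ->; rewrite !inE negb_or BU.
- apply/forall_inP => X XM; move/forall_inP: H2 => /(_ _ XM) /forall_inP /(_ B).
  rewrite setUCA setU11 => /(_ isT)/implyP; apply.
  by apply: contraNneq BM => ->.
- apply/forall_inP => Y; rewrite setUCA => /setU1P[->|Y_]; first by rewrite eqxx.
  by apply/implyP => _; move/forall_inP: H2; apply.
- apply/forall_inP => X XM; apply/forall_inP => Y; rewrite setUCA => /setU1P[->|Y_].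
    by apply/implyP => _; move/forall_inP: H3; apply.
  by move/forall_inP: H1 => /(_ _ XM) /forall_inP; apply.
Qed.

Lemma marked_partition_addU A K (S B : {set 'I_K}) (U M : {set {set 'I_K}}) : B \notin U -> B \notin M ->
  marked_partition A S (B |: U) M =
  [&& B != set0, B \subset S, marked_partition A (S :\: B) U M & free_fits A U M B].
Proof.
move=> BU BM; rewrite /marked_partition /free_fits -setUA.
rewrite partition_addE ?inE ?negb_or ?BU // disjointsU1 BM.
rewrite forall_inU1; case: (B != set0) => //=; case: (B \subset S) => //=.
case: (partition _ _) => //=; case: [disjoint _ & _] => //=.
case: [forall B0 in U, _]; rewrite ?andbF //=.
case: [forall B0 in M, _]; rewrite ?andbF //=.
case: (free_ok A B); rewrite ?andbF //=.
case: (planar_family A) => //=.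
rewrite /planar_pair -setUA.
apply/andP/andP => [[/forall_inP H1 /forall_inP H2]|].
  split; apply/andP; split.
  - apply/forall_inP => X XU; apply/forall_inP => Y YU.
    by move/forall_inP: (H1 X (setU1r _ XU)); apply; rewrite setU1r.
  - apply/forall_inP => X XM; apply/forall_inP => Y Y_.
    by move/forall_inP: (H2 X XM); apply; rewrite setU1r.
  - apply/forall_inP => Y YU; move/forall_inP: (H1 B (setU11 _ _)) => /(_ Y).
    rewrite setU1r // => /(_ isT)/implyP; apply.
    by apply: contraNneq BU => ->.
  - apply/forall_inP => X XM; move/forall_inP: (H2 X XM) => /(_ B).
    rewrite setU11 => /(_ isT)/implyP; apply.
    by apply: contraNneq BM => ->.
case=> /andP[/forall_inP H1 /forall_inP H2] /andP[/forall_inP H3 /forall_inP H4].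
split; apply/forall_inP => X XU; apply/forall_inP => Y /setU1P YU; apply/implyP => XY.
  case/setU1P: XU XY YU => [->|XU] XY [e|YU]; first by rewrite e eqxx in XY.
  - exact: H3.
  - by rewrite e noncrossing_sym H3.
  by move/forall_inP: (H1 X XU) => /(_ _ YU)/implyP; apply.
case: YU => [->|YU]; first exact: H4.
by move/forall_inP: (H2 X XU) => /(_ _ YU)/implyP; apply.
Qed.

Definition below K (X B : {set 'I_K}) : bool :=
  [forall x in X, exists b in B, x < b].

(** The marked blocks to which a letter larger than all others can be added: in
    a planar family, only the rightmost one. *)
Definition choosable A K (B : {set 'I_K}) (M : {set {set 'I_K}}) : bool :=
  planar_family A ==> [forall X in M, below X B].

Lemma belowP K (X B : {set 'I_K}) :
  reflect (forall x, x \in X -> exists2 b, b \in B & x < b) (below X B).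
Proof.
by apply: (iffP forall_inP) => H x xX; apply/exists_inP; apply: H.
Qed.

Lemma marked_ok_grow A K (j : 'I_K) (B : {set 'I_K}) : j \notin B -> B != set0 ->
  marked_ok A (j |: B) = allows_large A && marked_ok A B.
Proof.
move=> jB B0; rewrite /marked_ok cardsU1 jB.
by move: B0; rewrite -card_gt0; case: (allows_large A) => //=; lia.
Qed.

Lemma free_ok_grow A K (j : 'I_K) (B : {set 'I_K}) : j \notin B -> B != set0 ->
  free_ok A (j |: B) = allows_pairs A && marked_ok A B.
Proof.
move=> jB B0; rewrite /free_ok /marked_ok cardsU1 jB.
by move: B0; rewrite -card_gt0; case: A => //=; lia.
Qed.

(** If [j] is added to [B], the letters newly covered are those to the right of
    some letter of [B]; so the other marked blocks must have no letter to
    the right of [B]. *)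
Lemma grow_exposed K (j : 'I_K) (B : {set 'I_K}) (M : {set {set 'I_K}}) :
    B != set0 -> (forall X x, X \in M -> x \in X -> x < j /\ x \notin B) ->
    (forall b, b \in B -> b < j) ->
  [forall X in M, exposed X (j |: B)] =
  [forall X in M, exposed X B] && [forall X in M, below X B].
Proof.
case/set0Pn => b0 b0B Mj Bj.
apply/forall_inP/andP => [H|[/forall_inP H1 /forall_inP H2] X XM]; [split|].
- apply/forall_inP => X XM; apply/exposedP => x y z xX yB zB.
  by move/exposedP: (H X XM); apply; rewrite ?setU1r.
- apply/forall_inP => X XM; apply/belowP => x xX; exists b0 => //.
  have [xj xB] := Mj X x XM xX; rewrite ltnNge; apply/negP => le.
  move/exposedP: (H X XM) => /(_ x b0 j); apply; rewrite ?setU11 ?setU1r //.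
  rewrite ltn_neqAle le andbT; apply: contraNneq xB => e.
  by rewrite -(val_inj e).
apply/exposedP => x y z xX; have [xj _] := Mj X x XM xX.
case/setU1P => [->|yB]; first by move=> _; lia.
case/setU1P => [->|zB]; last exact: (exposedP _ _ (H1 X XM)).
move=> yx _; have /belowP/(_ x xX)[b bB xb] := H2 X XM.
exact: (exposedP _ _ (H1 X XM) x y b).
Qed.

(** A marked block with several letters is possible only in a family that allows
    large blocks; in the planar case [grow_exposed] says when adding [j] to
    a marked block is possible. *)
Lemma marked_fits_grow A K (j : 'I_K) (B : {set 'I_K}) (U M : {set {set 'I_K}}) :
    j \notin B -> B != set0 ->
    (forall X x, X \in U :|: M -> x \in X -> x < j /\ x \notin B) ->
    (forall b, b \in B -> b < j) ->
  marked_fits A U M (j |: B) =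
  [&& allows_large A, marked_fits A U M B & choosable A B M].
Proof.
move=> jB B0 UMj Bj; rewrite /marked_fits /choosable marked_ok_grow //.
have Mj X x : X \in M -> x \in X -> x < j /\ x \notin B.
  by move=> XM; apply: UMj; rewrite inE XM orbT.
rewrite (grow_exposed B0 Mj Bj) -!andbA; congr andb; congr andb.
case: (planar_family A) => //=; rewrite -andbA; congr andb.
apply/forall_inP/forall_inP => H Y Y_; apply/exposedP => x y z xB yY zY.
  by move/exposedP: (H Y Y_); apply; rewrite // setU1r.
case/setU1P: xB => [->|xB].
  by have [zj _] := UMj Y z Y_ zY; lia.
exact: (exposedP _ _ (H Y Y_)).
Qed.

(** For a free block containing the largest letter [j], being non-crossing with
    the other free blocks amounts to the rest [B] of this block being
    exposed: a free block passing over a letter of [B] would cross the arc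
    from this letter to [j]. So [B] could as well be marked, which is the
    key to the planar recursion. *)
Lemma free_fits_grow A K (j : 'I_K) (B : {set 'I_K}) (U M : {set {set 'I_K}}) :
    j \notin B -> B != set0 ->
    (forall X x, X \in U :|: M -> x \in X -> x < j /\ x \notin B) ->
    (forall b, b \in B -> b < j) ->
  free_fits A U M (j |: B) =
  [&& allows_pairs A, marked_fits A U M B & choosable A B M].
Proof.
move=> jB B0 UMj Bj; rewrite /free_fits /marked_fits /choosable free_ok_grow //.
have Mj X x : X \in M -> x \in X -> x < j /\ x \notin B.
  by move=> XM; apply: UMj; rewrite inE XM orbT.
rewrite -!andbA; congr andb; congr andb.
case: (planar_family A) => //=; rewrite -andbA -(grow_exposed B0 Mj Bj).
apply: andb_id2r => /forall_inP EX.
apply/forall_inP/forall_inP => H Y Y_.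
  apply/exposedP => x y z xB yY zY yx xz; case/setUP: (Y_) => YU.
    have [zj _] := UMj Y z Y_ zY.
    have [_] := noncrossingP _ _ (H Y YU) x j y z (setU1r _ xB) (setU11 _ _) yY zY.
    by apply.
  have [zj _] := UMj Y z Y_ zY.
  exact: (exposedP _ _ (EX Y YU) z x j zY (setU1r _ xB) (setU11 _ _)).
have Y' : Y \in U :|: M by rewrite inE Y_.
apply/noncrossingP => a b c d aB bB cY dY.
have [cj _] := UMj Y c Y' cY; have [dj _] := UMj Y d Y' dY.
split=> -[h1 h2 h3].
  case/setU1P: bB h2 h3 => [->|bB] h2 h3; first by lia.
  exact: (exposedP _ _ (H Y Y') b c d).
case/setU1P: aB h1 h2 => [->|aB] h1 h2; first by lia.
exact: (exposedP _ _ (H Y Y') a c d).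
Qed.

Lemma marked_partition_cover A K (S : {set 'I_K}) (U M : {set {set 'I_K}}) X :
  marked_partition A S U M -> X \in U :|: M -> X \subset S.
Proof. by case/and5P => pP *; apply: partitionS pP _. Qed.

Lemma grow_below A K (j : 'I_K) (S B : {set 'I_K}) (U M : {set {set 'I_K}}) :
    (forall x, x \in S -> x < j) -> B \subset S ->
    marked_partition A (S :\: B) U M ->
  (forall X x, X \in U :|: M -> x \in X -> x < j /\ x \notin B) /\
  (forall b, b \in B -> b < j).
Proof.
move=> Sj /subsetP BS mp; split=> [X x XUM xX|b /BS/Sj //].
have /subsetP/(_ x xX) := marked_partition_cover mp XUM.
by rewrite inE => /andP[xB /Sj].
Qed.

Lemma setU1D (T : finType) (j : T) (S B : {set T}) : j \notin S ->
  (j |: S) :\: (j |: B) = S :\: B.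
Proof.
move=> jS; apply/setP => x; rewrite !inE negb_or.
by case: eqP => //= ->; rewrite (negbTE jS) andbF.
Qed.

Lemma subsetU1 (T : finType) (j : T) (S B : {set T}) : j \notin B ->
  (j |: B \subset j |: S) = (B \subset S).
Proof.
move=> jB; apply/subsetP/subsetP => H x xB.
  have := H x (setU1r _ xB); case/setU1P => // e.
  by rewrite -e xB in jB.
by case/setU1P: xB => [->|/H xS]; rewrite ?setU11 ?setU1r.
Qed.

Lemma setU1_neq0 (T : finType) (j : T) (B : {set T}) : j |: B != set0.
Proof. by apply/set0Pn; exists j; rewrite setU11. Qed.

Lemma grow_marked A K (j : 'I_K) (S B : {set 'I_K}) (U M : {set {set 'I_K}}) :
    j \notin S -> (forall x, x \in S -> x < j) -> j \notin B -> B != set0 ->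
    B \notin U -> B \notin M -> j |: B \notin U -> j |: B \notin M ->
  marked_partition A (j |: S) U ((j |: B) |: M) =
  [&& allows_large A, marked_partition A S U (B |: M) & choosable A B M].
Proof.
move=> jS Sj jB B0 BU BM jBU jBM.
rewrite !marked_partition_addM // setU1_neq0 B0 subsetU1 // setU1D //=.
case: (boolP (B \subset S)) => BS; last by rewrite /= andbF.
case: (boolP (marked_partition A (S :\: B) U M)) => mp; last by rewrite /= andbF.
by have [h1 h2] := grow_below Sj BS mp; rewrite marked_fits_grow.
Qed.

(** What remains of the free block of [j] is recorded as a marked block, so that
    marked and free blocks of [j] are counted by the same set. *)
Lemma grow_free A K (j : 'I_K) (S B : {set 'I_K}) (U M : {set {set 'I_K}}) :
    j \notin S -> (forall x, x \in S -> x < j) -> j \notin B -> B != set0 ->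
    B \notin U -> B \notin M -> j |: B \notin U -> j |: B \notin M ->
  marked_partition A (j |: S) ((j |: B) |: U) M =
  [&& allows_pairs A, marked_partition A S U (B |: M) & choosable A B M].
Proof.
move=> jS Sj jB B0 BU BM jBU jBM.
rewrite marked_partition_addU // marked_partition_addM // setU1_neq0 B0 subsetU1 // setU1D //=.
case: (boolP (B \subset S)) => BS; last by rewrite /= andbF.
case: (boolP (marked_partition A (S :\: B) U M)) => mp; last by rewrite /= andbF.
by have [h1 h2] := grow_below Sj BS mp; rewrite free_fits_grow.
Qed.

Lemma singleton_fits A K (j : 'I_K) (S : {set 'I_K}) (U M : {set {set 'I_K}}) :
    (forall x, x \in S -> x < j) -> marked_partition A S U M ->
  marked_fits A U M [set j] /\ free_fits A U M [set j] = allows_singletons A.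
Proof.
move=> Sj mp.
have lt X x : X \in U :|: M -> x \in X -> x < j.
  by move=> XUM xX; apply: Sj; apply: (subsetP (marked_partition_cover mp XUM)).
have e1 : [forall Y in U :|: M, exposed [set j] Y].
  apply/forall_inP => Y Y_; apply/exposedP => x y z /set1P -> yY zY.
  by have := lt _ _ Y_ zY; lia.
have e2 : [forall X in M, exposed X [set j]].
  by apply/forall_inP => Y Y_; apply/exposedP => x y z _ /set1P -> /set1P ->; lia.
have e3 : [forall Y in U, noncrossing (@nat_of_ord K) [set j] Y].
  apply/forall_inP => Y Y_; apply/noncrossingP => a b c d /set1P -> /set1P -> cY dY.
  by split=> -[]; lia.
rewrite /marked_fits /free_fits /marked_ok /free_ok e1 e2 e3 cards1 implybT orbT.
by split=> //; case: A {mp}.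
Qed.

Lemma add_singleton_marked A K (j : 'I_K) (S : {set 'I_K}) (U M : {set {set 'I_K}}) :
    j \notin S -> (forall x, x \in S -> x < j) -> [set j] \notin U -> [set j] \notin M ->
  marked_partition A (j |: S) U ([set j] |: M) = marked_partition A S U M.
Proof.
move=> jS Sj jU jM; rewrite marked_partition_addM // -card_gt0 cards1 sub1set setU11 /=.
rewrite setU1K //; apply: andb_idr => mp.
by have [-> _] := singleton_fits Sj mp.
Qed.

Lemma add_singleton_free A K (j : 'I_K) (S : {set 'I_K}) (U M : {set {set 'I_K}}) :
    j \notin S -> (forall x, x \in S -> x < j) -> [set j] \notin U -> [set j] \notin M ->
  marked_partition A (j |: S) ([set j] |: U) M =
  allows_singletons A && marked_partition A S U M.
Proof.
move=> jS Sj jU jM; rewrite marked_partition_addU // -card_gt0 cards1 sub1set setU11 /=.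
rewrite setU1K // [RHS]andbC; apply: andb_id2l => mp.
by have [_ ->] := singleton_fits Sj mp.
Qed.

(** In a planar family the chosen block must contain the largest marked letter,
    which determines it. *)
Lemma card_choosable A K (S : {set 'I_K}) (U M : {set {set 'I_K}}) :
  marked_partition A S U M ->
  #|[set B in M | choosable A B (M :\ B)]| = choices A #|M|.
Proof.
move=> mp; rewrite /choosable /choices; case: (planar_family A) => /=; last first.
  by apply: eq_card => B; rewrite inE andbT.
have [-> |M0] := eqVneq M set0.
  by rewrite cards0; apply/eqP; rewrite cards_eq0; apply/eqP/setP => B; rewrite !inE.
have pP : partition (U :|: M) S by case/and5P: mp.
have [B1 B1M] := set0Pn _ M0.
have [j1 j1B1] : exists j1, j1 \in B1.
  by apply/set0Pn; apply: partition_neq0 pP _; rewrite inE B1M orbT.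
have j1c : j1 \in cover M by apply/bigcupP; exists B1.
case: (arg_maxnP (fun x : 'I_K => x : nat) j1c) => j0 /bigcupP[B0 B0M j0B0] jmax.
rewrite card_gt0 M0; apply/eqP/cards1P; exists B0; apply/setP => B; rewrite !inE.
apply/andP/eqP => [[BM /forall_inP sel]|->].
  apply/eqP; apply/negPn/negP => ne.
  have /belowP/(_ _ j0B0)[b bB] : below B0 B by apply: sel; rewrite !inE eq_sym ne.
  by rewrite ltnNge => /negP; case; apply: jmax; apply/bigcupP; exists B.
split=> //; apply/forall_inP => X /setD1P[XB0 XM]; apply/belowP => x xX.
exists j0 => //; rewrite ltn_neqAle; apply/andP; split; last first.
  by apply: jmax; apply/bigcupP; exists X.
apply: contraNneq XB0 => /val_inj e.
have t := partition_trivIset pP.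
rewrite -(def_pblock t _ xX) ?inE ?XM ?orbT //.
by rewrite e (def_pblock t _ j0B0) ?inE ?B0M ?orbT.
Qed.

Lemma card_bij (aT rT : finType) (X : {set aT}) (Y : {set rT}) (f : aT -> rT) g :
    (forall x, x \in X -> f x \in Y) -> (forall y, y \in Y -> g y \in X) ->
    {in X, cancel f g} -> {in Y, cancel g f} ->
  #|X| = #|Y|.
Proof.
move=> fXY gYX fK gK; apply/eqP; rewrite eqn_leq; apply/andP; split.
  rewrite -(card_in_imset (can_in_inj fK)); apply: subset_leq_card.
  by apply/subsetP => _ /imsetP[x xX ->]; apply: fXY.
rewrite -(card_in_imset (can_in_inj gK)); apply: subset_leq_card.
by apply/subsetP => _ /imsetP[x xX ->]; apply: gYX.
Qed.

Lemma card_dep_pairs (aT rT : finType) (X : {set aT}) (Q : aT -> pred rT) :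
  #|[set p : aT * rT | (p.1 \in X) && Q p.1 p.2]| = \sum_(x in X) #|[set y | Q x y]|.
Proof.
rewrite -sum1dep_card -(pair_big_dep (mem X) Q (fun _ _ => 1)) /=.
by apply: eq_bigr => x _; rewrite sum1dep_card.
Qed.

Definition marked_partitions A K (S : {set 'I_K}) m :=
  [set W : {set {set 'I_K}} * {set {set 'I_K}} |
     marked_partition A S W.1 W.2 && (#|W.2| == m)].

(** Partitions with a distinguished choosable marked block. The first component
    is this block and the last one consists of the other marked blocks only,
    so that the block can be modified, or moved to the free ones, without
    being removed first. *)
Definition pointed_partitions A K (S : {set 'I_K}) m :=
  [set t : {set 'I_K} * ({set {set 'I_K}} * {set {set 'I_K}}) |
     [&& t.1 \notin t.2.1, t.1 \notin t.2.2, marked_partition A S t.2.1 (t.1 |: t.2.2),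
         choosable A t.1 t.2.2 & #|t.2.2|.+1 == m]].

Lemma card_pointed_partitions A K (S : {set 'I_K}) m :
  #|pointed_partitions A S m| = choices A m * #|marked_partitions A S m|.
Proof.
pose Z := [set p : ({set {set 'I_K}} * {set {set 'I_K}}) * {set 'I_K} |
   (p.1 \in marked_partitions A S m) && ((p.2 \in p.1.2) && choosable A p.2 (p.1.2 :\ p.2))].
transitivity #|Z|; last first.
  rewrite (card_dep_pairs _ (fun (W : {set {set 'I_K}} * {set {set 'I_K}}) (B : {set 'I_K}) => (B \in W.2) && choosable A B (W.2 :\ B))).
  rewrite mulnC -sum_nat_const; apply: eq_bigr => W; rewrite inE => /andP[mp /eqP <-].
  by rewrite -(card_choosable mp).
apply: (card_bij (f := fun t => ((t.2.1, t.1 |: t.2.2), t.1))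
                 (g := fun p => (p.2, (p.1.1, p.1.2 :\ p.2)))).
- case=> B [U M]; rewrite !inE /= => /and5P[BU BM -> ch /eqP <-].
  by rewrite cardsU1 BM setU1K // !eqxx.
- case=> -[U M] B; rewrite !inE /= => /and3P[/andP[mp /eqP <-] BM ch].
  rewrite setD1K // mp ch eqxx /= (cardsD1 B M) BM eqxx !andbT.
  case/and5P: mp => _ /disjointFl/(_ BM) -> *; by [].
- by case=> B [U M]; rewrite !inE /= => /and5P[BU BM _ _ _]; rewrite setU1K.
by case=> -[U M] B; rewrite !inE /= => /and3P[_ BM _]; rewrite setD1K.
Qed.

Lemma fresh_block A K (j : 'I_K) (S X : {set 'I_K}) (U M : {set {set 'I_K}}) :
  marked_partition A S U M -> j \notin S -> j \in X -> X \notin U /\ X \notin M.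
Proof.
move=> mp jS jX; apply/andP; rewrite -negb_or -in_setU; apply/negP => XUM.
by move/subsetP: (marked_partition_cover mp XUM) => /(_ _ jX); rewrite (negbTE jS).
Qed.

(** When [j] is not alone, removing it from its block leaves a non-empty set
    that is not already a block, because blocks are disjoint. *)
Lemma block_of A K (j : 'I_K) (S : {set 'I_K}) (U M : {set {set 'I_K}}) :
    marked_partition A S U M -> j \in S -> [set j] \notin U -> [set j] \notin M ->
    let B := pblock (U :|: M) j in
  [/\ B \in U :|: M, j \in B, B :\ j != set0, B :\ j \notin U & B :\ j \notin M].
Proof.
move=> mp jS jU jM B; have pP : partition (U :|: M) S by case/and5P: mp.
have jc : j \in cover (U :|: M) by rewrite (cover_partition pP).
have BP : B \in U :|: M by apply: pblock_mem.
have jB : j \in B by rewrite mem_pblock.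
have B0 : B :\ j != set0.
  apply/negP => /eqP B0; move: BP; rewrite -(setD1K jB) B0 setU0 inE.
  by rewrite (negbTE jU) (negbTE jM).
split=> //.
  all: have [x xB] := set0Pn _ B0; have xB' := xB; move/setD1P: xB' => [xj xB'].
  all: apply/negP => BjP.
  all: have BjUM : B :\ j \in U :|: M by rewrite inE BjP ?orbT.
  all: have tr := partition_trivIset pP.
  all: have e := etrans (esym (def_pblock tr BjUM xB)) (def_pblock tr BP xB').
  all: by move: jB; rewrite -e setD11.
Qed.

Lemma card_splitP (T : finType) (X : {set T}) (p : pred T) :
  #|X| = #|[set x in X | p x]| + #|[set x in X | ~~ p x]|.
Proof.
rewrite -(cardsID [set x | p x] X); congr addn.
  by apply: eq_card => x; rewrite !inE.
by apply: eq_card => x; rewrite !inE andbC.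
Qed.

Lemma marked_notin_free A K (S X : {set 'I_K}) (U M : {set {set 'I_K}}) :
  marked_partition A S U M -> X \in M -> X \notin U.
Proof. by case/and5P => _ /disjointFl dj _ _ _ /dj ->. Qed.

Lemma card_last_marked_singleton A K (j : 'I_K) (S : {set 'I_K}) m :
    j \notin S -> (forall x, x \in S -> x < j) ->
  #|[set W in marked_partitions A (j |: S) m | [set j] \in W.2]| =
  if m is m'.+1 then #|marked_partitions A S m'| else 0.
Proof.
move=> jS Sj; case: m => [|m].
  apply/eqP; rewrite cards_eq0; apply/eqP/setP => -[U M]; rewrite !inE /=.
  by rewrite cards_eq0 -andbA; apply/and3P => -[_ /eqP ->]; rewrite inE.
apply: (card_bij (f := fun W => (W.1, W.2 :\ [set j]))
                 (g := fun W => (W.1, [set j] |: W.2))).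
- case=> U M; rewrite !inE /= => /andP[/andP[mp /eqP c] jM].
  have jU := marked_notin_free mp jM.
  rewrite -(add_singleton_marked _ jS Sj jU) ?setD11 // setD1K // mp.
  by move: c; rewrite (cardsD1 [set j] M) jM add1n => -[->]; rewrite /= eqxx.
- case=> U M; rewrite !inE /= => /andP[mp /eqP c].
  have [jU jM] := fresh_block mp jS (set11 j).
  by rewrite add_singleton_marked // mp cardsU1 jM c !eqxx.
- by case=> U M; rewrite !inE /= => /andP[_ jM]; rewrite setD1K.
case=> U M; rewrite !inE /= => /andP[mp _].
by have [jU jM] := fresh_block mp jS (set11 j); rewrite setU1K.
Qed.

Lemma card_last_free_singleton A K (j : 'I_K) (S : {set 'I_K}) m :
    j \notin S -> (forall x, x \in S -> x < j) ->
  #|[set W in marked_partitions A (j |: S) m | [set j] \in W.1]| =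
  allows_singletons A * #|marked_partitions A S m|.
Proof.
move=> jS Sj.
have D U M : marked_partition A (j |: S) U M -> [set j] \in U ->
    [/\ [set j] \notin M, allows_singletons A & marked_partition A S (U :\ [set j]) M].
  move=> mp jU; have jM : [set j] \notin M.
    by apply/negP => /(marked_notin_free mp); rewrite jU.
  have := mp; rewrite -{1}(setD1K jU) (add_singleton_free _ jS Sj _ jM) ?setD11 //.
  by case/andP.
case s : (allows_singletons A); last first.
  rewrite mul0n; apply/eqP; rewrite cards_eq0; apply/eqP/setP => -[U M].
  rewrite !inE /=; apply/negP => /andP[/andP[mp _] jU].
  by have [_] := D U M mp jU; rewrite s.
rewrite mul1n.
apply: (card_bij (f := fun W => (W.1 :\ [set j], W.2))
                 (g := fun W => ([set j] |: W.1, W.2))).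
- case=> U M; rewrite !inE /= => /andP[/andP[mp c] jU].
  by have [_ _ ->] := D U M mp jU.
- case=> U M; rewrite !inE /= => /andP[mp c].
  have [jU jM] := fresh_block mp jS (set11 j).
  by rewrite add_singleton_free // mp c s !eqxx.
- by case=> U M; rewrite !inE /= => /andP[_ jU]; rewrite setD1K.
case=> U M; rewrite !inE /= => /andP[mp _].
by have [jU jM] := fresh_block mp jS (set11 j); rewrite setU1K.
Qed.

Lemma pointed_block_spec A K (j : 'I_K) (S B : {set 'I_K}) (U M : {set {set 'I_K}}) :
    marked_partition A S U (B |: M) -> j \notin S ->
  [/\ j \notin B, B != set0, j |: B \notin U & j |: B \notin M].
Proof.
move=> mp jS; have BP : B \in U :|: (B |: M) by rewrite !inE eqxx orbT.
have [jU] := fresh_block mp jS (setU11 j B); rewrite inE negb_or => /andP[_ jM].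
split=> //; last by case/and5P: mp => pP *; apply: partition_neq0 pP BP.
by apply: contra jS; apply: (subsetP (marked_partition_cover mp BP)).
Qed.

Definition block_at K (j : 'I_K) (W : {set {set 'I_K}} * {set {set 'I_K}}) :=
  pblock (W.1 :|: W.2) j.

Lemma block_at_eq A K (j : 'I_K) (S B : {set 'I_K}) (U M : {set {set 'I_K}}) :
  marked_partition A S U M -> B \in U :|: M -> j \in B -> block_at j (U, M) = B.
Proof. by case/and5P => pP *; apply: def_pblock (partition_trivIset pP) _ _. Qed.

Lemma set1_neq_setU1 (T : finType) (j : T) (B : {set T}) :
  j \notin B -> B != set0 -> [set j] != j |: B.
Proof.
move=> jB; apply: contraNneq => ejB; rewrite -subset0; apply/subsetP => x xB.
have : x \in [set j] by rewrite ejB setU1r.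
by move/set1P => xj; rewrite -xj xB in jB.
Qed.

(** The letter [j] is removed from its block, which becomes the distinguished
    marked block. *)
Lemma card_last_in_marked_block A K (j : 'I_K) (S : {set 'I_K}) m :
    j \notin S -> (forall x, x \in S -> x < j) ->
  #|[set W in marked_partitions A (j |: S) m |
      [&& [set j] \notin W.2, [set j] \notin W.1 & block_at j W \in W.2]]| =
  allows_large A * #|pointed_partitions A S m|.
Proof.
move=> jS Sj.
have D U M : marked_partition A (j |: S) U M -> [set j] \notin M -> [set j] \notin U ->
    let B := pblock (U :|: M) j in B \in M ->
    [&& allows_large A, B :\ j \notin U, B :\ j \notin M :\ B,
      marked_partition A S U ((B :\ j) |: (M :\ B)) & choosable A (B :\ j) (M :\ B)].
  move=> mp jM jU; have := block_of mp (setU11 j S) jU jM.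
  rewrite /=; move: (pblock _ j) => B [_ jB B0 BU BM'] BM.
  have BMB : B :\ j \notin M :\ B by rewrite inE (negbTE BM') andbF.
  have BnU := marked_notin_free mp BM.
  move: mp; rewrite -{1}(setD1K BM) -{1}(setD1K jB) grow_marked ?setD11 ?setD1K ?setD11 //.
  by case/and3P=> -> -> ->; rewrite BU BMB.
case s : (allows_large A); last first.
  rewrite mul0n; apply/eqP; rewrite cards_eq0; apply/eqP/setP => -[U M].
  rewrite !inE /=; apply/negP => /andP[/andP[mp _] /and3P[jM jU BM]].
  by have := D U M mp jM jU BM; rewrite s.
rewrite mul1n.
apply: (card_bij (f := fun W => (block_at j W :\ j, (W.1, W.2 :\ block_at j W)))
                 (g := fun t => (t.2.1, (j |: t.1) |: t.2.2))).
- case=> U M; rewrite inE /= inE /= => /andP[/andP[mp /eqP c] /and3P[jM jU BM]].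
  have := D U M mp jM jU BM; case/and5P => _ h1 h2 h3 h4.
  by rewrite inE /= h1 h2 h3 h4 -c (cardsD1 (block_at j (U, M)) M) BM eqxx.
- case=> B [U M]; rewrite inE /= => /and5P[BU BM mp ch /eqP <-].
  have [jB B0 jBU jBM] := pointed_block_spec mp jS.
  have mp' : marked_partition A (j |: S) U ((j |: B) |: M) by rewrite grow_marked // s mp ch.
  have e : block_at j (U, (j |: B) |: M) = j |: B.
    by apply: block_at_eq mp' _ (setU11 j B); rewrite !inE eqxx orbT.
  rewrite !inE /= mp' cardsU1 jBM add1n eqxx e eqxx andbT /=.
  have njB := set1_neq_setU1 jB B0.
  have [jU'] := fresh_block mp jS (set11 j); rewrite inE negb_or => /andP[_ jM'].
  by rewrite negb_or njB jU' jM'.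
- case=> U M; rewrite inE /= inE /= => /andP[/andP[mp /eqP c] /and3P[jM jU BM]].
  have [_ jB _ _ _] := block_of mp (setU11 j S) jU jM.
  by rewrite setD1K // setD1K.
case=> B [U M]; rewrite inE /= => /and5P[BU BM mp ch /eqP _].
have [jB B0 jBU jBM] := pointed_block_spec mp jS.
have mp' : marked_partition A (j |: S) U ((j |: B) |: M) by rewrite grow_marked // s mp ch.
have e : block_at j (U, (j |: B) |: M) = j |: B.
  by apply: block_at_eq mp' _ (setU11 j B); rewrite !inE eqxx orbT.
by rewrite e setU1K // setU1K.
Qed.

(** The letter [j] is removed from its block, which is moved to the marked ones
    and becomes the distinguished one; this raises the number of marked
    blocks by one. *)
Lemma card_last_in_free_block A K (j : 'I_K) (S : {set 'I_K}) m :
    j \notin S -> (forall x, x \in S -> x < j) ->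
  #|[set W in marked_partitions A (j |: S) m |
      [&& [set j] \notin W.2, [set j] \notin W.1 & block_at j W \notin W.2]]| =
  allows_pairs A * #|pointed_partitions A S m.+1|.
Proof.
move=> jS Sj.
have D U M : marked_partition A (j |: S) U M -> [set j] \notin M -> [set j] \notin U ->
    let B := pblock (U :|: M) j in B \notin M ->
    [&& B \in U, allows_pairs A, B :\ j \notin U :\ B, B :\ j \notin M &
      marked_partition A S (U :\ B) ((B :\ j) |: M) && choosable A (B :\ j) M].
  move=> mp jM jU; have := block_of mp (setU11 j S) jU jM.
  rewrite /=; move: (pblock _ j) => B [BP jB B0 BU BM'] BM.
  have {BP} BP : B \in U by move: BP; rewrite inE (negbTE BM) orbF.
  have BUB : B :\ j \notin U :\ B by rewrite inE (negbTE BU) andbF.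
  move: mp; rewrite -{1}(setD1K BP) -{1}(setD1K jB) grow_free ?setD11 ?setD1K ?setD11 //.
  by case/and3P=> -> -> ->; rewrite BP BUB BM'.
case s : (allows_pairs A); last first.
  rewrite mul0n; apply/eqP; rewrite cards_eq0; apply/eqP/setP => -[U M].
  rewrite !inE /=; apply/negP => /andP[/andP[mp _] /and3P[jM jU BM]].
  by have := D U M mp jM jU BM; rewrite s andbF.
rewrite mul1n.
apply: (card_bij (f := fun W => (block_at j W :\ j, (W.1 :\ block_at j W, W.2)))
                 (g := fun t => ((j |: t.1) |: t.2.1, t.2.2))).
- case=> U M; rewrite inE /= inE /= => /andP[/andP[mp /eqP c] /and3P[jM jU BM]].
  have := D U M mp jM jU BM; case/and5P => _ _ h1 h2 /andP[h3 h4].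
  by rewrite inE /= h1 h2 h3 h4 -c eqxx.
- case=> B [U M]; rewrite inE /= => /and5P[BU BM mp ch /eqP [c]].
  have [jB B0 jBU jBM] := pointed_block_spec mp jS.
  have mp' : marked_partition A (j |: S) ((j |: B) |: U) M by rewrite grow_free // s mp ch.
  have e : block_at j ((j |: B) |: U, M) = j |: B.
    by apply: block_at_eq mp' _ (setU11 j B); rewrite !inE eqxx.
  rewrite !inE /= mp' c eqxx e jBM /= andbT.
  have njB := set1_neq_setU1 jB B0.
  have [jU'] := fresh_block mp jS (set11 j); rewrite inE negb_or => /andP[_ jM'].
  by rewrite negb_or njB jU' jM'.
- case=> U M; rewrite inE /= inE /= => /andP[/andP[mp /eqP c] /and3P[jM jU BM]].
  have [_ jB _ _ _] := block_of mp (setU11 j S) jU jM.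
  by have := D U M mp jM jU BM; case/and5P => BU *; rewrite setD1K // setD1K.
case=> B [U M]; rewrite inE /= => /and5P[BU BM mp ch /eqP _].
have [jB B0 jBU jBM] := pointed_block_spec mp jS.
have mp' : marked_partition A (j |: S) ((j |: B) |: U) M by rewrite grow_free // s mp ch.
have e : block_at j ((j |: B) |: U, M) = j |: B.
  by apply: block_at_eq mp' _ (setU11 j B); rewrite !inE eqxx.
by rewrite e setU1K // setU1K.
Qed.

Lemma card_marked_partitions_rec A K (j : 'I_K) (S : {set 'I_K}) m :
    j \notin S -> (forall x, x \in S -> x < j) ->
  #|marked_partitions A (j |: S) m| =
    (if m is m'.+1 then #|marked_partitions A S m'| else 0)
    + (allows_singletons A + allows_large A * choices A m) * #|marked_partitions A S m|
    + allows_pairs A * choices A m.+1 * #|marked_partitions A S m.+1|.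
Proof.
move=> jS Sj; rewrite mulnDl -!mulnA -!card_pointed_partitions.
rewrite -(@card_last_marked_singleton A K j S m jS Sj) -(@card_last_free_singleton A K j S m jS Sj).
rewrite -(@card_last_in_marked_block A K j S m jS Sj) -(@card_last_in_free_block A K j S m jS Sj).
rewrite (card_splitP _ (fun W : {set {set 'I_K}} * {set {set 'I_K}} => [set j] \in W.2)) -!addnA; congr addn.
rewrite (card_splitP _ (fun W : {set {set 'I_K}} * {set {set 'I_K}} => [set j] \in W.1)); congr addn.
  apply: eq_card => W; rewrite !inE; case: (boolP ([set j] \in W.1)) => jU; rewrite ?andbF //.
  rewrite !andbT; apply: andb_idr => /andP[mp _].
  by apply/negP => /(marked_notin_free mp); rewrite jU.
rewrite (card_splitP _ (fun W : {set {set 'I_K}} * {set {set 'I_K}} => block_at j W \in W.2)); congr addn;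
  by apply: eq_card => W; rewrite !inE -!andbA.
Qed.

Lemma card_marked_partitions A K j m : j <= K ->
  #|marked_partitions A [set i : 'I_K | i < j] m| = marked_count A j m.
Proof.
elim: j m => [|j IH] m jK.
  have -> : [set i : 'I_K | i < 0] = set0 by apply/setP => i; rewrite !inE.
  rewrite /=; case: m => [|m].
    apply/eqP/cards1P; exists (set0, set0); apply/setP => -[U M]; rewrite !inE /=.
    rewrite cards_eq0 xpair_eqE; apply/andP/andP => [[mp /eqP M0]|[/eqP -> /eqP ->]].
      by move: mp; rewrite M0 /marked_partition setU0 partition_set0 => /and5P[].
    rewrite eqxx; split=> //; rewrite /marked_partition setU0 partition_set0 eqxx.
    rewrite -setI_eq0 setI0 eqxx /=.
    apply/and3P; split; first by apply/forall_inP => B; rewrite inE.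
      by apply/forall_inP => B; rewrite inE.
    by apply/implyP => _; apply/andP; split; apply/forall_inP => B; rewrite inE.
  apply/eqP; rewrite cards_eq0; apply/eqP/setP => -[U M]; rewrite !inE /=.
  apply/negP => /andP[/and5P[]]; rewrite partition_set0 setU_eq0 => /andP[_ /eqP ->].
  by rewrite cards0.
have -> : [set i : 'I_K | i < j.+1] = Ordinal jK |: [set i : 'I_K | i < j].
  by apply/setP => i; rewrite !inE ltnS leq_eqVlt -val_eqE.
rewrite card_marked_partitions_rec; [|by rewrite inE ltnn|by move=> x; rewrite inE].
by rewrite /= !IH ?(ltnW jK) //; case: m => [|m] //; rewrite IH // ltnW.
Qed.

(** * Linear extensions and standard fillings *)

(** Order-preserving labellings of the poset [S] by the elements of [M], with
    the value [x0] off [S]. The labels are compared through [key], and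
    fixing the ambient type of cells avoids any transport when a cell is
    removed from [S]. *)
Definition lin_ext (C X : finType) (lt : rel C) (key : X -> nat) (x0 : X)
    (S : {set C}) (M : {set X}) : {set {ffun C -> X}} :=
  [set L : {ffun C -> X} | [&& L @: S == M, [forall c, (c \notin S) ==> (L c == x0)]
    & [forall c in S, forall c' in S, lt c c' ==> (key (L c) < key (L c'))]]].

Definition maximal_in (C : finType) (lt : rel C) (S : {set C}) (c : C) : bool :=
  (c \in S) && [forall c' in S, ~~ lt c c'].

Lemma lin_extP (C X : finType) (lt : rel C) (key : X -> nat) (x0 : X)
    (S : {set C}) (M : {set X}) (L : {ffun C -> X}) :
  reflect [/\ L @: S = M, forall c, c \notin S -> L c = x0 &
    forall c c', c \in S -> c' \in S -> lt c c' -> key (L c) < key (L c')]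
   (L \in lin_ext lt key x0 S M).
Proof.
rewrite inE; apply: (iffP and3P) => -[H1 H2 H3]; split.
- exact/eqP.
- by move=> c cS; move/forallP: H2 => /(_ c)/implyP/(_ cS)/eqP.
- move=> c c' cS c'S; move/forall_inP: H3 => /(_ c cS)/forall_inP/(_ c' c'S).
  by move/implyP.
- exact/eqP.
- by apply/forallP => c; apply/implyP => cS; apply/eqP/H2.
by apply/forall_inP => c cS; apply/forall_inP => c' c'S; apply/implyP; apply: H3.
Qed.

(** The largest label [B] can be put only on a maximal element, and removing it
    there is reversible. *)
Lemma card_lin_ext_max (C X : finType) (lt : rel C) (key : X -> nat) (x0 : X)
    (S : {set C}) (M : {set X}) (B : X) (c : C) :
    irreflexive lt -> #|S| = #|M| -> B \in M ->
    (forall Y, Y \in M -> Y != B -> key Y < key B) -> c \in S ->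
  #|[set L in lin_ext lt key x0 S M | L c == B]| =
  maximal_in lt S c * #|lin_ext lt key x0 (S :\ c) (M :\ B)|.
Proof.
move=> ltxx SM BM Bmax cS.
have inj L : L \in lin_ext lt key x0 S M -> {in S &, injective L}.
  by case/lin_extP => LS _ _; apply/imset_injP; rewrite LS SM.
have [cm|] := boolP (maximal_in lt S c); last first.
  rewrite /maximal_in cS /= negb_forall_in => /exists_inP[c' c'S]; rewrite negbK => cc'.
  rewrite mul0n; apply/eqP; rewrite cards_eq0; apply/eqP/setP => L; rewrite inE [RHS]inE.
  apply/negP => /andP[LL /eqP LcB]; have Li := inj L LL; case/lin_extP: LL => LS _ Lk.
  have := Lk _ _ cS c'S cc'; rewrite LcB; apply/negP; rewrite -leqNgt ltnW // Bmax //.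
    by rewrite -LS imset_f.
  rewrite -LcB; apply/eqP => /(Li _ _ c'S cS) e.
  by rewrite e ltxx in cc'.
rewrite mul1n; have /andP[_ /forall_inP cmax] := cm.
pose upd (y : X) (L : {ffun C -> X}) : {ffun C -> X} := [ffun d => if d == c then y else L d].
apply: (card_bij (f := upd x0) (g := upd B)) => L.
- rewrite inE => /andP[LL /eqP LcB]; have Li := inj L LL; case/lin_extP: LL => LS L0 Lk.
  apply/lin_extP; split.
  + apply/setP => Y; apply/imsetP/setD1P => [[d /setD1P[dc dS] ->]|[YB]].
      rewrite ffunE (negbTE dc); split; last by rewrite -LS imset_f.
      by rewrite -LcB; apply: contra dc => /eqP/(Li _ _ dS cS) ->.
    rewrite -LS => /imsetP[d dS e]; exists d.
      by apply/setD1P; split=> //; apply: contraNneq YB => dc; rewrite e dc LcB.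
    rewrite ffunE; case: eqP => // dc.
    by rewrite e dc LcB eqxx in YB.
  + move=> d; rewrite ffunE; case: eqP => // /eqP dc.
    by rewrite in_setD1 dc => /L0.
  move=> d d' /setD1P[dc dS] /setD1P[d'c d'S] dd'.
  by rewrite !ffunE (negbTE dc) (negbTE d'c) Lk.
- case/lin_extP => LS L0 Lk; rewrite inE ffunE !eqxx andbT.
  apply/lin_extP; split.
  + rewrite -{1}(setD1K cS) imsetU1 ffunE eqxx -(setD1K BM); congr (_ |: _).
    rewrite -LS; apply: eq_in_imset => d /setD1P[dc _].
    by rewrite ffunE (negbTE dc).
  + move=> d dS; rewrite ffunE; case: eqP => [dc|_]; first by rewrite dc cS in dS.
    by apply: L0; rewrite in_setD1 (negbTE dS) andbF.
  move=> d d' dS d'S dd'; rewrite !ffunE.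
  case: (eqVneq d c) dd' => [->|dc] dd'; first by rewrite (negbTE (cmax _ d'S)) in dd'.
  have dS' : d \in S :\ c by rewrite in_setD1 dc.
  case: eqP => [_|/eqP d'c]; last by apply: Lk => //; rewrite in_setD1 d'c.
  have : L d \in M :\ B by rewrite -LS imset_f.
  by case/setD1P => LB LM; apply: Bmax.
- rewrite inE => /andP[_ /eqP LcB]; apply/ffunP => d; rewrite !ffunE.
  by case: eqP => [->|].
case/lin_extP => _ L0 _; apply/ffunP => d; rewrite !ffunE; case: eqP => [->|] //.
by rewrite L0 // setD11.
Qed.

Lemma card_lin_ext_rec (C X : finType) (lt : rel C) (key : X -> nat) (x0 : X)
    (S : {set C}) (M : {set X}) (B : X) :
    irreflexive lt -> #|S| = #|M| -> B \in M ->
    (forall Y, Y \in M -> Y != B -> key Y < key B) ->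
  #|lin_ext lt key x0 S M| =
  \sum_(c | maximal_in lt S c) #|lin_ext lt key x0 (S :\ c) (M :\ B)|.
Proof.
move=> ltxx SM BM Bmax.
have -> : \sum_(c | maximal_in lt S c) #|lin_ext lt key x0 (S :\ c) (M :\ B)| =
    \sum_(c in S) #|[set L in lin_ext lt key x0 S M | L c == B]|.
  rewrite big_mkcond [RHS]big_mkcond; apply: eq_bigr => c _.
  case: (boolP (c \in S)) => cS; last by rewrite /maximal_in (negbTE cS).
  by rewrite (card_lin_ext_max _ ltxx SM BM Bmax cS); case: ifP; rewrite ?mul1n ?mul0n.
rewrite (eq_bigr (fun c => \sum_(L in lin_ext lt key x0 S M) (L c == B))); last first.
  move=> c _; rewrite -sum1dep_card -big_mkcondr /=.
  by apply: eq_bigl => L; rewrite andbC.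
(* Each linear extension takes the value [B] at exactly one cell. *)
rewrite exchange_big -sum1_card /=; apply: eq_bigr => L /lin_extP[LS _ _].
have Li : {in S &, injective L} by apply/imset_injP; rewrite LS SM.
have /imsetP[c cS e] : B \in L @: S by rewrite LS.
rewrite (bigD1 c) //= e eqxx big1 // => d /andP[dS dc].
by apply/eqP; rewrite eqb0; apply: contra dc => /eqP/Li ->.
Qed.

Definition young_diagram K (nu : seq nat) : {set 'I_K * 'I_K} :=
  [set c : 'I_K * 'I_K | c.2 < nth 0 nu c.1].

(** Increasing along rows and down columns is the same as being order-preserving
    for this relation. *)
Definition south_east K : rel ('I_K * 'I_K) := fun c c' =>
  [&& c != c', c.1 <= c'.1 & c.2 <= c'.2].

Lemma size_le_sumn nu : is_part nu -> size nu <= sumn nu.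
Proof.
case/andP=> _; elim: nu => //= x nu IH; rewrite in_cons negb_or => /andP[x0 /IH].
by case: x x0 => // x _; lia.
Qed.

Lemma nth_le_sumn nu i : nth 0 nu i <= sumn nu.
Proof. by elim: nu i => [|x nu IH] [|i] //=; [lia | have := IH i; lia]. Qed.

Lemma part_mono nu i j : is_part nu -> i <= j -> nth 0 nu j <= nth 0 nu i.
Proof.
move=> /is_partP[H _] /subnK ej; rewrite -ej; elim: (j - i) => //= d IH.
by apply: leq_trans IH; rewrite addSn.
Qed.

Lemma maximal_young_diagram K nu (c : 'I_K * 'I_K) : is_part nu -> sumn nu <= K ->
  maximal_in (@south_east K) (young_diagram K nu) c =
  removable nu c.1 && (c.2 == (nth 0 nu c.1).-1 :> nat).
Proof.
case: c => i j pn nK; rewrite /maximal_in inE /=.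
apply/andP/andP => [[jS /forall_inP cmax]|[r /eqP ej]].
  have nij : ~~ (j.+1 < nth 0 nu i).
    apply/negP => h; have jK : j.+1 < K by have := nth_le_sumn nu i; lia.
    have := cmax (i, Ordinal jK); rewrite inE => /(_ h) /negP; apply.
    by rewrite /south_east /= leqnn leqnSn !andbT xpair_eqE eqxx -val_eqE /= neq_ltn leqnn.
  split; last by apply/eqP; lia.
  rewrite /removable; case: (posnP (nth 0 nu i.+1)) => [->|p]; first by lia.
  have iK : i.+1 < K.
    have := size_le_sumn pn; suff : i.+1 < size nu by lia.
    by rewrite ltnNge; apply/negP => /(nth_default 0) e; rewrite e in p.
  have := cmax (Ordinal iK, j); rewrite inE /south_east /= leqnSn leqnn !andbT.
  by rewrite xpair_eqE -val_eqE /= (ltn_eqF (ltnSn i)) /=; lia.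
have jS : j < nth 0 nu i by move: r; rewrite /removable ej; lia.
split=> //; apply/forall_inP => -[i' j']; rewrite inE /= => j'S.
apply/negP => /and3P[ne /= ii' jj'].
have mono := part_mono pn ii'.
move: ii'; rewrite leq_eqVlt => /orP[/eqP e|lt]; last first.
  by have := part_mono pn lt; move: r; rewrite /removable; lia.
move: ne; rewrite xpair_eqE -!val_eqE /= e eqxx /=; rewrite -e in j'S.
by apply/negP; rewrite negbK; lia.
Qed.

Lemma young_diagram_decr_row K nu (c : 'I_K * 'I_K) : is_part nu ->
    removable nu c.1 -> c.2 = (nth 0 nu c.1).-1 :> nat ->
  young_diagram K nu :\ c = young_diagram K (decr_row nu c.1).
Proof.
case: c => i j pn r /= ej; apply/setP => -[i' j']; rewrite !inE /= nth_decr_row //.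
rewrite xpair_eqE -!val_eqE /= (eq_sym (i : nat)).
case: eqP => [->|_] /=; last by rewrite subn0.
by move: r; rewrite /removable; lia.
Qed.

Lemma sum_maximal_young_diagram K nu (F : seq nat -> nat) : is_part nu -> sumn nu <= K ->
  \sum_(c | maximal_in (@south_east K) (young_diagram K nu) c) F (decr_row nu c.1) =
  \sum_(x <- down nu) F x.
Proof.
move=> pn nK; rewrite (@sum_down_rows _ K); last exact: leq_trans (size_le_sumn pn) nK.
rewrite (reindex_onto (fun i : 'I_K => (i, insubd i (nth 0 nu i).-1)) fst) /=.
  apply: eq_bigl => i; rewrite maximal_young_diagram //= eqxx andbT.
  apply: andb_idr => r; rewrite val_insubd.
  have := nth_le_sumn nu i; move: r; rewrite /removable.
  by case: (ltnP _.-1 K) => //; lia.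
move=> -[i j]; rewrite maximal_young_diagram //= => /andP[r /eqP ej]; congr pair.
by apply: val_inj; rewrite val_insubd -ej ltn_ord.
Qed.

Lemma last_removable nu : is_part nu -> nu != [::] -> removable nu (size nu).-1.
Proof.
case/is_partP => _ H n0; rewrite /removable prednK ?lt0n ?size_eq0 //.
by rewrite nth_default // H // prednK // lt0n size_eq0.
Qed.

Lemma card_young_diagram K nu : is_part nu -> sumn nu <= K -> #|young_diagram K nu| = sumn nu.
Proof.
move e : (sumn nu) => m; elim: m nu e => [|m IH] nu e pn nK.
  have -> : nu = [::] by apply/eqP; rewrite -sumn_eq0 // e.
  by apply/eqP; rewrite cards_eq0; apply/eqP/setP => c; rewrite !inE nth_nil.
have r : removable nu (size nu).-1 by rewrite last_removable // -sumn_eq0 // e.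
have iK : (size nu).-1 < K by have := size_le_sumn pn; have := removable_lt r; lia.
have jK : (nth 0 nu (size nu).-1).-1 < K.
  by have := nth_le_sumn nu (size nu).-1; move: r; rewrite /removable; lia.
pose c := (Ordinal iK, Ordinal jK).
have cS : c \in young_diagram K nu by rewrite inE /=; move: r; rewrite /removable; lia.
have [pd _ e'] := decr_rowP pn r.
rewrite (cardsD1 c) cS (@young_diagram_decr_row K nu c pn r) // add1n; congr _.+1.
apply: IH => //; last exact: ltnW.
by move: e; rewrite -{1}e' sumn_incr_nth => -[].
Qed.

(** The removal of the largest label takes a corner off the diagram, so that
    these labellings satisfy the recursion of [nsyt]. *)
Lemma card_lin_ext_young_diagram K (X : finType) (key : X -> nat) (x0 : X) nu (M : {set X}) :
    is_part nu -> sumn nu <= K -> #|M| = sumn nu -> {in M &, injective key} ->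
  #|lin_ext (@south_east K) key x0 (young_diagram K nu) M| = nsyt nu.
Proof.
move e : (sumn nu) => m; elim: m nu e M => [|m IH] nu e M pn nK cM ki.
  have -> : nu = [::] by apply/eqP; rewrite -sumn_eq0 // e.
  have -> : M = set0 by apply/eqP; rewrite -cards_eq0 cM.
  apply/eqP/cards1P; exists [ffun=> x0].
  have s0 : young_diagram K [::] = set0 by apply/setP => c; rewrite !inE nth_nil.
  apply/setP => L; rewrite [RHS]inE s0; apply/lin_extP/eqP => [[_ L0 _]|->].
    by apply/ffunP => c; rewrite ffunE L0 // inE.
  by split=> [|c _|c c']; rewrite ?imset0 ?ffunE ?inE.
have [B0 B0M] : exists B, B \in M by apply/set0Pn; rewrite -card_gt0 cM.
case: (arg_maxnP key B0M) => B BM' Bmax'; have {BM'} BM : B \in M := BM'.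
have Bmax Y : Y \in M -> Y != B -> key Y < key B.
  move=> YM YB; rewrite ltn_neqAle; apply/andP; split; last exact: Bmax'.
  by apply: contra YB => /eqP/ki ->.
rewrite (card_lin_ext_rec _ _ _ BM Bmax); last 2 first.
- by move=> c; rewrite /south_east eqxx.
- by rewrite card_young_diagram ?e.
rewrite -sum_down_nsyt // -?sumn_eq0 ?e // -(@sum_maximal_young_diagram K) ?e //.
apply: eq_bigr => c; rewrite maximal_young_diagram ?e // => /andP[r /eqP ec].
have [pd sd e'] := decr_rowP pn r.
rewrite young_diagram_decr_row //; apply: IH => //.
- by move: e; rewrite -{1}e' sumn_incr_nth => -[].
- exact: ltnW.
- by apply/eqP; move: cM; rewrite (cardsD1 B M) BM add1n => -[->].
by move=> Y Z /setD1P[_ YM] /setD1P[_ ZM]; apply: ki.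
Qed.

(** * Entries and blocks of a tableau *)

Lemma cell_ext la (c c' : cell la) :
  cell_row c = cell_row c' -> cell_col c = cell_col c' -> c = c'.
Proof.
case: c => i j; case: c' => i' j'; rewrite /cell_row /cell_col /= => /val_inj e.
by case: _ / e j' => j' /val_inj ->.
Qed.

Lemma cell_colP la (c : cell la) : cell_col c < nth 0 la (cell_row c).
Proof. exact: ltn_ord. Qed.

Lemma cell_rowP la (c : cell la) : cell_row c < size la.
Proof. exact: ltn_ord. Qed.

Lemma cellP la i j : j < nth 0 la i ->
  exists2 c : cell la, cell_row c = i & cell_col c = j.
Proof.
move=> ji; have il : i < size la.
  by rewrite ltnNge; apply/negP => /(nth_default 0) e; rewrite e in ji.
by exists (existT (fun i : 'I_(size la) => 'I_(nth 0 la i)) (Ordinal il) (Ordinal ji)).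
Qed.

(** Coordinates instead of dependent cells; the empty set outside of the diagram
    agrees with the default value of [lin_ext]. *)
Definition entry k la (T : filling k la) (i j : nat) : {set 'I_k} :=
  if [pick c : cell la | (cell_row c == i) && (cell_col c == j)] is Some c
  then T c else set0.

Lemma entryE k la (T : filling k la) c : entry T (cell_row c) (cell_col c) = T c.
Proof.
rewrite /entry; case: pickP => [c' /andP[/eqP r /eqP l]|/(_ c)].
  by rewrite (cell_ext r l).
by rewrite !eqxx.
Qed.

Lemma entry_default k la (T : filling k la) i j : nth 0 la i <= j -> entry T i j = set0.
Proof.
move=> h; rewrite /entry; case: pickP => // c /andP[/eqP r /eqP l].
by have := cell_colP c; rewrite r l ltnNge h.
Qed.

Lemma last_letter_gt0 k (X : {set 'I_k}) : (0 < last_letter X) = (X != set0).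
Proof.
apply/idP/set0Pn => [|[x xX]].
  by case: (set_0Vmem X) => [->|[x xX]]; [rewrite /last_letter big_set0|exists x].
exact: leq_trans (ltn0Sn x) (bigmax_sup x xX (leqnn _)).
Qed.

Lemma last_letter_attained k (X : {set 'I_k}) : X != set0 ->
  exists2 x, x \in X & last_letter X = x.+1.
Proof.
rewrite -card_gt0 => X0.
by have [x xX e] := eq_bigmax_cond (fun x : 'I_k => x.+1) X0; exists x.
Qed.

(** Both sets contain their common largest letter. *)
Lemma last_letter_inj k (X Y : {set 'I_k}) : X != set0 ->
  last_letter X = last_letter Y -> exists2 x, x \in X & x \in Y.
Proof.
move=> X0 e; have Y0 : Y != set0 by rewrite -last_letter_gt0 -e last_letter_gt0.
have [x xX ex] := last_letter_attained X0; have [y yY ey] := last_letter_attained Y0.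
exists x => //; suff -> : x = y by [].
by apply: val_inj; move: e; rewrite ex ey => -[].
Qed.

Lemma lle_trans k : transitive (@lle k).
Proof.
move=> Y X Z; rewrite /lle /llt => /predU1P[->|h1] // /predU1P[<-|h2]; rewrite ?h1 ?orbT //.
by rewrite (ltn_trans h1 h2) orbT.
Qed.

Lemma lle_anti k : antisymmetric (@lle k).
Proof.
move=> X Y; rewrite /lle /llt => /andP[/predU1P[->|h1] // /predU1P[->|h2] //].
by have := ltn_trans h1 h2; rewrite ltnn.
Qed.

(** The dictionary between a tableau and the pair formed by the free blocks [U]
    and the marked blocks [M]. The empty set is not a block, but it may
    occupy several cells of the first row. *)
Record has_blocks k la (T : filling k la) (U M : {set {set 'I_k}}) : Prop := HasBlocks {
  first_row_in : forall c, cell_row c = 0 -> T c != set0 -> T c \in U;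
  first_row_onto : forall B, B \in U -> B != set0 /\ exists2 c, cell_row c = 0 & T c = B;
  lower_in : forall c, cell_row c != 0 -> T c \in M;
  lower_onto : forall B, B \in M -> B != set0 /\ exists2 c, cell_row c != 0 & T c = B;
  entries_inj : forall c c', T c != set0 -> T c = T c' -> c = c' }.

(** The sizes allowed in the first row for the families all of whose tableaux
    are matching. *)
Definition free_sizes A : seq nat :=
  0 :: (if allows_singletons A then [:: 1] else [::])
    ++ (if allows_pairs A then [:: 2] else [::]).

Lemma noncrossing0 k (X : {set 'I_k}) :
  noncrossing (@nat_of_ord k) set0 X && noncrossing (@nat_of_ord k) X set0.
Proof. by apply/andP; split; apply/noncrossingP => a b c d; rewrite !inE. Qed.

Lemma exposed0 k (X : {set 'I_k}) : exposed X set0.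
Proof. by apply/exposedP => x y z _; rewrite inE. Qed.

Lemma planar_tableauE k la (T : filling k la) U M : has_blocks T U M ->
  size la <= 2 -> planar_tableau T = planar_pair U M.
Proof.
case=> fin fon lin lon inj sz; rewrite /planar_tableau /planar_pair sz /=.
congr andb.
  apply/forallP/forall_inP => [H X XU|H c].
    apply/forall_inP => Y YU; apply/implyP => XY.
    have [X0 [c r e]] := fon X XU; have [Y0 [c' r' e']] := fon Y YU.
    move/forallP: (H c) => /(_ c'); rewrite r r' e e' /= => /implyP; apply.
    by apply: contraNneq XY => cc'; rewrite -e -e' cc'.
  apply/forallP => c'; apply/implyP => /and3P[/eqP r /eqP r' cc'].
  have [->|X0] := eqVneq (T c) set0; first by case/andP: (noncrossing0 (T c')).
  have [->|Y0] := eqVneq (T c') set0; first by case/andP: (noncrossing0 (T c)).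
  move/forall_inP: (H _ (fin c r X0)) => /(_ _ (fin c' r' Y0))/implyP; apply.
  by apply: contra cc' => /eqP/(inj _ _ X0) ->.
apply/forallP/forall_inP => [H X XM|H c].
  apply/forall_inP => Y YUM; apply/implyP => XY.
  have [X0 [c r e]] := lon X XM.
  have [c' e'] : exists c', T c' = Y.
    by case/setUP: YUM => [/fon|/lon] [_ [c' _ e']]; exists c'.
  move/forallP: (H c) => /(_ c'); rewrite e e' => /implyP; apply.
  apply/andP; split.
    by have := cell_rowP c; move: r; case: (cell_row c) => [|[|i]] // _ /leq_trans/(_ sz).
  by apply: contraNneq XY => cc'; rewrite -e -e' cc'.
apply/forallP => c'; apply/implyP => /andP[/eqP r cc'].
have r0 : cell_row c != 0 by rewrite r.
have [->|Y0] := eqVneq (T c') set0; first exact: exposed0.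
move/forall_inP: (H _ (lin c r0)) => /(_ (T c')).
rewrite inE; have -> : (T c' \in U) || (T c' \in M).
  have [r'|r'] := eqVneq (cell_row c') 0; first by rewrite fin.
  by rewrite lin ?orbT.
move=> /(_ isT)/implyP; apply; apply: contra cc' => /eqP/(inj _ _ Y0) ->.
by [].
Qed.

Lemma matching_tableauE A k la (T : filling k la) U M : has_blocks T U M ->
    ~~ allows_large A ->
  matching_tableau T && first_row_sizes (free_sizes A) T =
  [forall B in U, free_ok A B] && [forall B in M, marked_ok A B].
Proof.
case=> fin fon lin lon inj /negbTE nl.
have okE (B : {set 'I_k}) : (#|B| \in free_sizes A) = (B == set0) || free_ok A B.
  rewrite /free_ok nl /= /free_sizes in_cons cards_eq0 mem_cat; congr (_ || (_ || _)).
    by case: (allows_singletons A); rewrite ?inE.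
  by case: (allows_pairs A); rewrite ?inE.
have le2 n : n \in free_sizes A -> n <= 2.
  rewrite /free_sizes in_cons mem_cat => /or3P[/eqP -> //||].
    by case: (allows_singletons A); rewrite ?inE // => /eqP ->.
  by case: (allows_pairs A); rewrite ?inE // => /eqP ->.
apply/andP/andP => -[/forallP H1 H2].
  split; apply/forall_inP => B BUM.
    have [B0 [c r e]] := fon B BUM; move/forallP: H2 => /(_ c)/implyP.
    by rewrite r okE e (negbTE B0); apply.
  have [_ [c r e]] := lon B BUM; have := H1 c.
  by rewrite (negbTE r) e /marked_ok nl.
have F c : cell_row c = 0 -> #|T c| \in free_sizes A.
  move=> r; rewrite okE; have [//|B0] := eqVneq (T c) set0.
  exact: (implyP (H1 (T c)) (fin c r B0)).
split; apply/forallP => c; last by apply/implyP => /eqP; apply: F.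
case: eqP => [r|/eqP r]; first exact/le2/F.
by move/forall_inP: H2 => /(_ _ (lin c r)); rewrite /marked_ok nl.
Qed.

Lemma family_tableauE A k la (T : filling k la) U M : has_blocks T U M ->
    planar_family A ==> (size la <= 2) ->
  family_tableau A T = [&& [forall B in U, free_ok A B],
    [forall B in M, marked_ok A B] & planar_family A ==> planar_pair U M].
Proof.
move=> hb; have PL := planar_tableauE hb; have MT := matching_tableauE (A := A) hb.
have big : allows_large A -> [forall B in U, free_ok A B] && [forall B in M, marked_ok A B].
  move=> l; apply/andP; split; apply/forall_inP => B _.
    by rewrite /free_ok l.
  by rewrite /marked_ok l.
rewrite [RHS]andbA; case: (boolP (allows_large A)) => l.
  by rewrite big //; case: A l {MT big} => // _ /= /PL ->.
rewrite -MT //; case: A l {MT big} => // _ /= h; rewrite ?andbT // -(PL h).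
all: by rewrite -[RHS]andbA; congr andb; apply: andbC.
Qed.

(** * Counting the tableaux *)

Lemma block_eq (T : finType) (P : {set {set T}}) (S X Y : {set T}) x :
  partition P S -> X \in P -> Y \in P -> x \in X -> x \in Y -> X = Y.
Proof.
move=> /partition_trivIset t XP YP xX xY.
by rewrite -(def_pblock t XP xX) (def_pblock t YP xY).
Qed.

Lemma last_letter_block_inj k (P : {set {set 'I_k}}) S :
  partition P S -> {in P &, injective (@last_letter k)}.
Proof.
move=> pP X Y XP YP e.
have [x xX xY] := last_letter_inj (partition_neq0 pP XP) e.
exact: block_eq pP XP YP xX xY.
Qed.

(** Two sets with the same last letter are incomparable unless they are equal;
    disjoint non-empty sets never have the same last letter. *)
Lemma lle_block_total k (P : {set {set 'I_k}}) S :
  partition P S -> {in P &, total (@lle k)}.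
Proof.
move=> pP X Y XP YP; rewrite /lle /llt; case: ltngtP; rewrite ?orbT // => e.
by rewrite (last_letter_block_inj pP XP YP e) eqxx.
Qed.

Lemma lle0 k (X : {set 'I_k}) : lle set0 X.
Proof.
have -> : lle set0 X = (set0 == X) || (0 < last_letter X).
  by rewrite /lle /llt [last_letter set0]big_set0.
by rewrite last_letter_gt0 eq_sym orbN.
Qed.

(** The only possible first row of length [a] with [U] as its set of non-empty
    entries. *)
Definition sorted_row k a (U : {set {set 'I_k}}) : seq {set 'I_k} :=
  nseq (a - #|U|) set0 ++ sort (@lle k) (enum U).

Lemma sorted_row_sorted k a (P U : {set {set 'I_k}}) S :
  partition P S -> U \subset P -> sorted (@lle k) (sorted_row a U).
Proof.
move=> pP /subsetP UP; rewrite /sorted_row.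
have : sorted (@lle k) (sort (@lle k) (enum U)).
  apply: (@sort_sorted_in _ [in U]); last by apply/allP => X; rewrite mem_enum.
  by move=> X Y /UP XP /UP YP; apply: (lle_block_total pP).
elim: (a - #|U|) => //= n IH /IH.
by case: (nseq n set0 ++ _) => //= X s ->; rewrite lle0.
Qed.

Lemma size_sorted_row k a (U : {set {set 'I_k}}) :
  #|U| <= a -> size (sorted_row a U) = a.
Proof. by move=> h; rewrite size_cat size_nseq size_sort -cardE subnK. Qed.

Definition first_row_blocks k la (T : filling k la) : {set {set 'I_k}} :=
  (T @: [set c | cell_row c == 0]) :\ set0.

Definition lower_blocks k la (T : filling k la) : {set {set 'I_k}} :=
  T @: [set c | cell_row c != 0].

Definition lower_filling k la (T : filling k la) : {ffun 'I_k * 'I_k -> {set 'I_k}} :=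
  [ffun c : 'I_k * 'I_k => entry T c.1.+1 c.2].

Lemma has_blocksE k la (T : filling k la) U M : has_blocks T U M ->
  first_row_blocks T = U /\ lower_blocks T = M.
Proof.
case=> fin fon lin lon _; split; apply/setP => B.
  apply/setD1P/idP => [[B0 /imsetP[c]]|BU].
    by rewrite inE => /eqP r e; rewrite e; apply: fin; rewrite -?e.
  by have [B0 [c r e]] := fon B BU; split=> //; rewrite -e imset_f // inE r.
apply/imsetP/idP => [[c]|BM]; first by rewrite inE => r ->; apply: lin.
by have [_ [c r e]] := lon B BM; exists c; rewrite ?inE ?r.
Qed.

Lemma standard_unique k la (T : filling k la) x c c' :
  standard_multiset_tableau T -> x \in T c -> x \in T c' -> c = c'.
Proof.
case/and3P => /forallP/(_ x)/cards1P[c0 e] _ _ xc xc'.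
have : c \in [set c | x \in T c] by rewrite inE.
have : c' \in [set c | x \in T c] by rewrite inE.
by rewrite e => /set1P -> /set1P ->.
Qed.

Lemma standard_cover k la (T : filling k la) x :
  standard_multiset_tableau T -> exists c, x \in T c.
Proof.
case/and3P => /forallP/(_ x)/cards1P[c0 e] _ _; exists c0.
have : c0 \in [set c | x \in T c] by rewrite e set11.
by rewrite inE.
Qed.

Lemma standard_column k la (T : filling k la) c c' :
    standard_multiset_tableau T -> cell_col c = cell_col c' ->
    cell_row c' = (cell_row c).+1 -> last_letter (T c) < last_letter (T c').
Proof.
case/and3P => _ _ /forallP/(_ c)/forallP/(_ c')/implyP H ec er.
by apply: H; rewrite ec er !eqxx.
Qed.

Lemma standard_row k la (T : filling k la) c c' :
    standard_multiset_tableau T -> cell_row c = cell_row c' ->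
    cell_col c < cell_col c' -> lle (T c) (T c').
Proof.
case/and3P => _ /forallP/(_ c)/forallP/(_ c')/implyP H _ er lc.
by apply: H; rewrite er eqxx.
Qed.

(** Columns are strictly increasing, so only the first row can contain the empty
    set. *)
Lemma standard_lower_neq0 k la (T : filling k la) c : is_part la ->
  standard_multiset_tableau T -> cell_row c != 0 -> T c != set0.
Proof.
move=> pla st; case r : (cell_row c) => [//|i] _.
have ci : cell_col c < nth 0 la i.
  by apply: leq_trans (cell_colP c) _; rewrite r part_mono.
have [c' r' l'] := cellP ci.
rewrite -last_letter_gt0; apply: leq_ltn_trans (leq0n _) (standard_column st l' _).
by rewrite r r'.
Qed.

Lemma standard_has_blocks k la (T : filling k la) : is_part la ->
  standard_multiset_tableau T -> has_blocks T (first_row_blocks T) (lower_blocks T).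
Proof.
move=> pla st; split.
- by move=> c r c0; rewrite in_setD1 c0 imset_f // inE r.
- move=> B /setD1P[B0 /imsetP[c]]; rewrite inE => /eqP r e; split=> //.
  by exists c.
- by move=> c r; rewrite imset_f // inE.
- move=> B /imsetP[c]; rewrite inE => r ->; split; last by exists c.
  exact: standard_lower_neq0.
move=> c c' /set0Pn[x xc] e; apply: (standard_unique st xc); by rewrite -e.
Qed.

Lemma standard_partition k la (T : filling k la) U M :
    has_blocks T U M -> standard_multiset_tableau T ->
  partition (U :|: M) setT /\ [disjoint U & M].
Proof.
case=> fin fon lin lon inj st.
have onto B : B \in U :|: M -> B != set0 /\ exists c, T c = B.
  by case/setUP => [/fon|/lon] [B0 [c _ e]]; split=> //; exists c.
have into c : T c != set0 -> T c \in U :|: M.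
  move=> c0; rewrite inE; case: (eqVneq (cell_row c) 0) => r.
    by rewrite fin.
  by rewrite lin ?orbT.
split.
  apply/and3P; split.
  - rewrite eqEsubset subsetT; apply/subsetP => x _; apply/bigcupP.
    have [c xc] := standard_cover x st; exists (T c) => //.
    by apply: into; apply/set0Pn; exists x.
  - apply/trivIsetP => X Y /onto[X0 [c e]] /onto[Y0 [c' e']] XY.
    rewrite -setI_eq0; apply/eqP/setP => x; rewrite !inE; apply/negP => /andP[xX xY].
    rewrite -e in xX; rewrite -e' in xY.
    by move: XY; rewrite -e -e' (standard_unique st xX xY) eqxx.
  by apply/negP => /onto[]; rewrite eqxx.
rewrite -setI_eq0; apply/eqP/setP => X; rewrite !inE; apply/negP => /andP[XU XM].
have [X0 [c r e]] := fon X XU; have [_ [c' r' e']] := lon X XM.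
have cc' : c = c' by apply: inj; rewrite e.
by rewrite -cc' r in r'.
Qed.

(** The cells between [c] and [c'] in their column belong to the diagram, as the
    parts of a partition decrease. *)
Lemma standard_column_mono k la (T : filling k la) c c' : is_part la ->
    standard_multiset_tableau T -> cell_col c = cell_col c' ->
    cell_row c < cell_row c' -> last_letter (T c) < last_letter (T c').
Proof.
move=> pla st; move d : (cell_row c' - (cell_row c).+1) => n.
elim: n c' d => [|n IH] c' d ec lr.
  by apply: standard_column => //; lia.
have hi : cell_col c' < nth 0 la (cell_row c').-1.
  by apply: leq_trans (cell_colP c') _; rewrite part_mono //; lia.
have [c1 r1 l1] := cellP hi.
apply: ltn_trans (IH c1 _ _ _) (standard_column st _ _); rewrite ?l1 ?r1 //; lia.
Qed.

(** From [c] one first goes along the row, to the column of [c'], then down this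
    column; the corner reached is a cell since the parts decrease. Entries
    of the lower rows are non-empty and distinct, so the inequality along
    the row is strict. *)
Lemma standard_lower_mono k la (T : filling k la) c c' : is_part la ->
    standard_multiset_tableau T -> cell_row c != 0 -> c != c' ->
    cell_row c <= cell_row c' -> cell_col c <= cell_col c' ->
  last_letter (T c) < last_letter (T c').
Proof.
move=> pla st r cc' lr lc.
have row_lt c1 c2 : cell_row c1 != 0 -> cell_row c1 = cell_row c2 ->
    cell_col c1 < cell_col c2 -> last_letter (T c1) < last_letter (T c2).
  move=> r1 er l12; have := standard_row st er l12; rewrite /lle => /predU1P[e|//].
  have hb := standard_has_blocks pla st.
  have c12 := entries_inj hb (standard_lower_neq0 pla st r1) e.
  by rewrite c12 ltnn in l12.
move: lc; rewrite leq_eqVlt => /orP[/eqP ec|lc].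
  apply: standard_column_mono => //; rewrite ltn_neqAle lr andbT.
  by apply: contra cc' => /eqP er; apply/eqP/cell_ext.
have hi : cell_col c' < nth 0 la (cell_row c).
  by apply: leq_trans (cell_colP c') _; rewrite part_mono.
have [c1 r1 l1] := cellP hi.
have lt1 : last_letter (T c) < last_letter (T c1) by apply: row_lt; rewrite ?r1 ?l1.
move: lr; rewrite leq_eqVlt => /orP[/eqP er|lr].
  by rewrite (_ : c' = c1) //; apply: cell_ext; rewrite ?r1 ?l1.
by apply: ltn_trans lt1 _; apply: standard_column_mono => //; rewrite r1.
Qed.

Lemma young_diagram_cellP k a nu (c : 'I_k * 'I_k) : c \in young_diagram k nu ->
  exists2 c' : cell (a :: nu), cell_row c' = c.1.+1 & cell_col c' = c.2.
Proof. by rewrite inE => h; apply: cellP. Qed.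

Lemma lower_cellP k a nu (c : cell (a :: nu)) : is_part nu -> sumn nu <= k ->
  cell_row c != 0 ->
  exists2 d : 'I_k * 'I_k, d \in young_diagram k nu & cell_row c = d.1.+1 /\ cell_col c = d.2.
Proof.
move=> pn nk; have h1 := cell_rowP c; have h2 := cell_colP c.
case r : (cell_row c) h1 h2 => [//|i] /= h1 h2 _.
have ik : i < k by have := size_le_sumn pn; lia.
have jk : cell_col c < k by have := nth_le_sumn nu i; lia.
by exists (Ordinal ik, Ordinal jk); rewrite ?inE.
Qed.

Lemma standard_lin_ext k a nu (T : filling k (a :: nu)) : is_part (a :: nu) ->
    is_part nu -> sumn nu <= k -> standard_multiset_tableau T ->
  lower_filling T \in
    lin_ext (@south_east k) (@last_letter k) set0 (young_diagram k nu) (lower_blocks T).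
Proof.
move=> pla pn nk st; apply/lin_extP; split.
- apply/setP => B; apply/imsetP/imsetP => -[c].
    move=> /(young_diagram_cellP a)[c' r' l'] ->; exists c'; first by rewrite inE r'.
    by rewrite ffunE -r' -l' entryE.
  rewrite inE => r ->; have [d dS [r' l']] := lower_cellP pn nk r; exists d => //.
  by rewrite ffunE -r' -l' entryE.
- move=> c; rewrite inE -leqNgt => h; rewrite ffunE.
  by rewrite entry_default.
move=> c d /(young_diagram_cellP a)[c' rc lc] /(young_diagram_cellP a)[d' rd ld].
rewrite !ffunE -rc -lc -rd -ld !entryE => /and3P[cd le1 le2].
apply: standard_lower_mono => //; rewrite ?rc ?rd ?lc ?ld //.
apply: contra cd => /eqP e; move: rc lc; rewrite e rd ld => -[e1] e2.
by case: c d e1 e2 {rd ld le1 le2} => c1 c2 [d1 d2] /= /val_inj -> /val_inj ->.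
Qed.

(** The row is sorted for an antisymmetric order, hence determined by its
    entries with multiplicity; non-empty entries occur once, and the length
    of the row gives the number of empty ones. *)
Lemma standard_first_row k a nu (T : filling k (a :: nu)) : is_part (a :: nu) ->
    standard_multiset_tableau T ->
  mkseq (entry T 0) a = sorted_row a (first_row_blocks T).
Proof.
move=> pla st; have hb := standard_has_blocks pla st.
have [pP _] := standard_partition hb st.
set U := first_row_blocks T.
have cell0 j : j < a -> exists2 c : cell (a :: nu), cell_row c = 0 & cell_col c = j.
  by move=> ja; apply: cellP.
have memr B : B != set0 -> (B \in mkseq (entry T 0) a) = (B \in U).
  move=> B0; apply/mapP/idP => [[j]|].
    rewrite mem_iota => /cell0[c r l] e; move: B0; rewrite e -r -l entryE.
    exact: first_row_in hb c r.
  case/(first_row_onto hb) => _ [c r e]; exists (cell_col c).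
    by rewrite mem_iota; have := cell_colP c; rewrite r.
  by rewrite -r entryE.
pose s1 := filter (pred1 set0) (mkseq (entry T 0) a).
pose s2 := filter (predC (pred1 set0)) (mkseq (entry T 0) a).
have p2 : perm_eq s2 (sort (@lle k) (enum U)).
  apply: uniq_perm; last 2 first.
  - by rewrite sort_uniq enum_uniq.
  - move=> B; rewrite mem_filter mem_sort mem_enum /=.
    have [e|B0] := eqVneq B set0; last by rewrite memr.
    by rewrite e; apply/esym/negP => /(first_row_onto hb)[]; rewrite eqxx.
  rewrite /s2 filter_map map_inj_in_uniq ?filter_uniq ?iota_uniq //.
  move=> i j; rewrite !mem_filter !mem_iota /= => /andP[i0 /cell0[c r l]].
  case/andP=> _ /cell0[c' r' l'] e.
  move: i0 e; rewrite -{1 2}r -r' -l -l' !entryE => c0.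
  by move/(entries_inj hb c0) ->.
have p : perm_eq (mkseq (entry T 0) a) (s1 ++ s2).
  by rewrite perm_sym; apply/permPl/perm_filterC.
have e1 : s1 = nseq (a - #|U|) set0.
  have /all_pred1P -> : all (pred1 set0) s1 by apply: filter_all.
  congr nseq; have := perm_size p; rewrite size_mkseq size_cat (perm_size p2).
  by rewrite size_sort -cardE => ->; rewrite addnK.
apply: (sorted_eq (@lle_trans k) (@lle_anti k)).
- apply/(sortedP set0) => j; rewrite size_mkseq => ja.
  rewrite !nth_mkseq ?(ltnW ja) //.
  have [c r l] := cell0 _ (ltnW ja); have [c' r' l'] := cell0 _ ja.
  rewrite -{1}r -{1}r' -l' -{1}l !entryE; apply: standard_row => //.
    by rewrite r r'.
  by rewrite l l'.
- apply: sorted_row_sorted pP _; exact: subsetUl.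
by rewrite (perm_trans p) // e1 perm_cat2l.
Qed.

Definition value_at k (L : {ffun 'I_k * 'I_k -> {set 'I_k}}) (i j : nat) : {set 'I_k} :=
  if [pick c : 'I_k * 'I_k | (c.1 == i :> nat) && (c.2 == j :> nat)] is Some c
  then L c else set0.

Lemma value_atE k (L : {ffun 'I_k * 'I_k -> {set 'I_k}}) (c : 'I_k * 'I_k) : value_at L c.1 c.2 = L c.
Proof.
rewrite /value_at; case: pickP => [[i j] /andP[/eqP r /eqP l]|/(_ c)].
  by case: c r l => i' j' /= /val_inj -> /val_inj ->.
by rewrite !eqxx.
Qed.

(** The inverse of the map that sends a tableau to its free blocks and to the
    filling of its lower rows. The marked blocks are the values of this
    filling. *)
Definition build_tableau k a nu (U : {set {set 'I_k}})
    (L : {ffun 'I_k * 'I_k -> {set 'I_k}}) : filling k (a :: nu) :=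
  [ffun c : cell (a :: nu) => if cell_row c is i.+1 then value_at L i (cell_col c)
     else nth set0 (sorted_row a U) (cell_col c)].

Lemma build_tableau_first k a nu (U : {set {set 'I_k}}) L (c : cell (a :: nu)) :
  cell_row c = 0 -> build_tableau a nu U L c = nth set0 (sorted_row a U) (cell_col c).
Proof. by move=> r; rewrite ffunE r. Qed.

Lemma build_tableau_lower k a nu (U : {set {set 'I_k}}) L (c : cell (a :: nu)) (d : 'I_k * 'I_k) :
  cell_row c = d.1.+1 -> cell_col c = d.2 -> build_tableau a nu U L c = L d.
Proof. by move=> r l; rewrite ffunE r l value_atE. Qed.

Lemma standard_buildK k a nu (T : filling k (a :: nu)) : is_part (a :: nu) ->
    is_part nu -> sumn nu <= k -> standard_multiset_tableau T ->
  build_tableau a nu (first_row_blocks T) (lower_filling T) = T.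
Proof.
move=> pla pn nk st; apply/ffunP => c.
have [r|r] := eqVneq (cell_row c) 0.
  rewrite build_tableau_first // -standard_first_row // -[RHS]entryE r nth_mkseq //.
  by have := cell_colP c; rewrite r.
have [d dS [r' l']] := lower_cellP pn nk r.
by rewrite (build_tableau_lower _ _ r' l') ffunE -r' -l' entryE.
Qed.

Lemma card_partition_le (T : finType) (P : {set {set T}}) (S : {set T}) :
  partition P S -> #|P| <= #|S|.
Proof.
move=> pP; rewrite (card_partition pP) -sum1_card; apply: leq_sum => B BP.
by rewrite card_gt0; apply: partition_neq0 pP BP.
Qed.

Lemma card_partition_pair k (U M : {set {set 'I_k}}) :
  partition (U :|: M) setT -> [disjoint U & M] -> #|U| + #|M| <= k.
Proof.
move=> pP dUM; have := card_partition_le pP; rewrite cardsT card_ord cardsU.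
by move: dUM; rewrite -setI_eq0 => /eqP ->; rewrite cards0 subn0.
Qed.

Lemma build_has_blocks k a nu (U M : {set {set 'I_k}}) L :
    is_part nu -> sumn nu = #|M| -> sumn nu <= k -> #|U| <= a ->
    partition (U :|: M) setT -> [disjoint U & M] ->
    L \in lin_ext (@south_east k) (@last_letter k) set0 (young_diagram k nu) M ->
  has_blocks (build_tableau a nu U L) U M.
Proof.
move=> pn nM nk Ua pP dUM /lin_extP[LS L0 Lk].
set T := build_tableau a nu U L.
have neq0 B : B \in U :|: M -> B != set0 by apply: partition_neq0 pP.
have Linj : {in young_diagram k nu &, injective L}.
  by apply/imset_injP; rewrite LS card_young_diagram // nM.
have lin c : cell_row c != 0 -> T c \in M.
  move=> r; have [d dS [r' l']] := lower_cellP pn nk r.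
  by rewrite /T (build_tableau_lower _ _ r' l') -LS imset_f.
have U0 : set0 \notin U.
  by apply/negP => h; have := neq0 set0; rewrite inE h eqxx => /(_ isT).
have rown j : j < a -> nth set0 (sorted_row a U) j != set0 ->
    nth set0 (sorted_row a U) j \in U /\ a - #|U| <= j.
  rewrite /sorted_row nth_cat size_nseq nth_nseq => ja.
  case: ltnP => h; first by rewrite eqxx.
  move=> _; split=> //; rewrite -mem_enum -(mem_sort (@lle k)); apply: mem_nth.
  by rewrite size_sort -cardE ltn_subLR // subnK.
have fin c : cell_row c = 0 -> T c != set0 -> T c \in U.
  move=> r; rewrite /T build_tableau_first // => /rown[] //.
  by have := cell_colP c; rewrite r.
have dis B : B \in U -> B \in M -> False by move=> BU; rewrite (disjointFr dUM BU).
split=> //.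
- move=> B BU; split; first by apply: neq0; rewrite inE BU.
  have : B \in sorted_row a U by rewrite mem_cat mem_sort mem_enum BU orbT.
  move/(nthP set0) => [j]; rewrite size_sorted_row // => ja e.
  have [c r l] : exists2 c : cell (a :: nu), cell_row c = 0 & cell_col c = j by apply: cellP.
  by exists c => //; rewrite /T build_tableau_first // l.
- move=> B BM; split; first by apply: neq0; rewrite inE BM orbT.
  move: (BM); rewrite -LS => /imsetP[d /(young_diagram_cellP a)[c r l] ->].
  by exists c; rewrite ?r // (build_tableau_lower _ _ r l).
move=> c c' c0 e.
have [r|r] := eqVneq (cell_row c) 0; have [r'|r'] := eqVneq (cell_row c') 0.
- move: c0 e; rewrite /T !build_tableau_first // => c0 e.
  have ca : cell_col c < a by have := cell_colP c; rewrite r.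
  have ca' : cell_col c' < a by have := cell_colP c'; rewrite r'.
  apply: cell_ext; first by rewrite r.
  have [_ h] := rown _ ca c0; have := c0; rewrite e => c0'; have [_ h'] := rown _ ca' c0'.
  move: e; rewrite /sorted_row !nth_cat size_nseq !ltnNge h h' /= => /eqP.
  rewrite nth_uniq ?sort_uniq ?enum_uniq ?size_sort -?cardE ?ltn_subLR ?subnK //.
  by move/eqP/(congr1 (addn^~ (a - #|U|))); rewrite !subnK.
- by case: (@dis (T c)); [apply: fin | rewrite e lin].
- by case: (@dis (T c')); [apply: fin => //; rewrite -e | rewrite -e lin].
have [d dS [rd ld]] := lower_cellP pn nk r; have [d' dS' [rd' ld']] := lower_cellP pn nk r'.
move: e; rewrite /T (build_tableau_lower _ _ rd ld) (build_tableau_lower _ _ rd' ld').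
by move/Linj => e; apply: cell_ext; rewrite ?rd ?rd' ?ld ?ld' e.
Qed.

(** The hypothesis on [a] leaves room, in the first row, for an empty cell above
    each cell of the second row. *)
Lemma build_standard k a nu (U M : {set {set 'I_k}}) L :
    is_part nu -> sumn nu = #|M| -> sumn nu <= k -> #|U| + nth 0 nu 0 <= a ->
    partition (U :|: M) setT -> [disjoint U & M] ->
    L \in lin_ext (@south_east k) (@last_letter k) set0 (young_diagram k nu) M ->
  standard_multiset_tableau (build_tableau a nu U L).
Proof.
move=> pn nM nk Ua pP dUM LL.
have Ua' : #|U| <= a by lia.
have hb := build_has_blocks pn nM nk Ua' pP dUM LL.
have [LS _ Lk] := lin_extP _ _ _ _ _ _ LL.
set T := build_tableau a nu U L in hb *.
have inP c : T c != set0 -> T c \in U :|: M.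
  move=> c0; rewrite inE; have [r|r] := eqVneq (cell_row c) 0.
    by rewrite (first_row_in hb).
  by rewrite (lower_in hb r) orbT.
have low c c' : cell_row c != 0 -> c != c' -> cell_row c <= cell_row c' ->
    cell_col c <= cell_col c' -> llt (T c) (T c').
  move=> r cc' lr lc; have r' : cell_row c' != 0 by rewrite -lt0n (leq_trans _ lr) // lt0n.
  have [d dS [rd ld]] := lower_cellP pn nk r; have [d' dS' [rd' ld']] := lower_cellP pn nk r'.
  rewrite /llt /T (build_tableau_lower _ _ rd ld) (build_tableau_lower _ _ rd' ld').
  apply: Lk => //; move: lr lc; rewrite rd rd' ld ld' /south_east ltnS => -> ->.
  rewrite !andbT; apply: contra cc' => /eqP e; apply/eqP/cell_ext; rewrite ?rd ?rd' ?ld ?ld' ?e //.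
apply/and3P; split.
- apply/forallP => x; apply/cards1P.
  have : x \in cover (U :|: M) by rewrite (cover_partition pP).
  case/bigcupP => B BP xB.
  have [c e] : exists c, T c = B.
    by case/setUP: BP => [/(first_row_onto hb)|/(lower_onto hb)] [_ [c _ e]]; exists c.
  exists c; apply/setP => c'; rewrite !inE; apply/idP/eqP => [xc'|->]; last by rewrite e.
  have c'0 : T c' != set0 by apply/set0Pn; exists x.
  apply: (entries_inj hb c'0); rewrite e.
  exact: block_eq pP (inP _ c'0) BP xc' xB.
- apply/forallP => c; apply/forallP => c'; apply/implyP => /andP[/eqP er lc].
  have [r|r] := eqVneq (cell_row c) 0; last first.
    apply/orP; right; apply: low => //; [|by rewrite er|exact: ltnW].
    by apply: contraTneq lc => ->; rewrite ltnn.
  have r' : cell_row c' = 0 by rewrite -er.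
  rewrite /T !build_tableau_first //.
  have so := sorted_row_sorted a pP (subsetUl U M).
  have ca : cell_col c < a by have := cell_colP c; rewrite r.
  have ca' : cell_col c' < a by have := cell_colP c'; rewrite r'.
  move: (sorted_ltn_nth (@lle_trans k) set0 so); apply; rewrite ?inE ?size_sorted_row //.
apply/forallP => c; apply/forallP => c'; apply/implyP => /andP[/eqP el /eqP er].
have [r|r] := eqVneq (cell_row c) 0; last first.
  apply: low => //; [|by rewrite er|by rewrite el].
  by apply: contra_eqN er => /eqP <-; rewrite neq_ltn leqnn.
have r' : cell_row c' != 0 by rewrite er.
(* The first row starts with [a - #|U|] empty cells, and [nu] has at most that
   many columns. *)
have -> : T c = set0.
  rewrite /T build_tableau_first // /sorted_row nth_cat size_nseq nth_nseq.
  have : cell_col c < nth 0 nu 0.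
    by rewrite el; have := cell_colP c'; rewrite er r.
  by case: (ltnP _ (a - #|U|)) => //; lia.
rewrite /llt [last_letter set0]big_set0 last_letter_gt0.
by apply: partition_neq0 pP _; rewrite inE (lower_in hb r') orbT.
Qed.

(** The hypothesis [2 * k <= a + sumn nu] gives the inequality required by
    [build_standard], as there are at most [k] blocks in total and [nu] has
    at most as many columns as there are marked blocks. *)
Lemma card_SMT A k a nu : is_part (a :: nu) -> 2 * k <= a + sumn nu ->
    sumn nu <= k -> planar_family A ==> (size nu <= 1) ->
  #|SMT A k (a :: nu)| = #|@marked_partitions A k setT (sumn nu)| * nsyt nu.
Proof.
move=> pla ka nk pl; have pn : is_part nu.
  by move: pla; rewrite /is_part in_cons negb_or => /andP[/path_sorted -> /andP[_ ->]].
pose Y := [set p : ({set {set 'I_k}} * {set {set 'I_k}}) * {ffun 'I_k * 'I_k -> {set 'I_k}} |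
  (p.1 \in marked_partitions A setT (sumn nu)) &&
  (p.2 \in lin_ext (@south_east k) (@last_letter k) set0 (young_diagram k nu) p.1.2)].
have -> : #|@marked_partitions A k setT (sumn nu)| * nsyt nu = #|Y|.
  rewrite (card_dep_pairs _ (fun (W : {set {set 'I_k}} * {set {set 'I_k}}) L =>
    L \in lin_ext (@south_east k) (@last_letter k) set0 (young_diagram k nu) W.2)).
  rewrite -sum_nat_const; apply: eq_bigr => -[U M]; rewrite inE /= => /andP[mp /eqP cM].
  rewrite -(@card_lin_ext_young_diagram k _ (@last_letter k) set0 nu M pn nk cM).
    by apply: eq_card => L; rewrite !inE.
  have pP : partition (U :|: M) setT by case/and5P: mp.
  by move=> X Z XM ZM; apply: (last_letter_block_inj pP); rewrite inE ?XM ?ZM orbT.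
have size2 : planar_family A ==> (size (a :: nu) <= 2) by [].
have facts (U M : {set {set 'I_k}}) : marked_partition A setT U M -> #|M| = sumn nu ->
    [/\ partition (U :|: M) setT, [disjoint U & M] & #|U| + nth 0 nu 0 <= a].
  move=> mp cM; have [pP dUM] : partition (U :|: M) setT /\ [disjoint U & M].
    by case/and5P: mp.
  split=> //; have := card_partition_pair pP dUM; have := nth_le_sumn nu 0; lia.
apply: (card_bij (f := fun T => ((first_row_blocks T, lower_blocks T), lower_filling T))
                 (g := fun p => build_tableau a nu p.1.1 p.2)).
- move=> T; rewrite inE => /andP[st fam].
  have hb := standard_has_blocks pla st; have [pP dUM] := standard_partition hb st.
  have LL := standard_lin_ext pla pn nk st.
  rewrite inE /= LL andbT inE /= /marked_partition pP dUM /=.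
  rewrite -(family_tableauE hb size2) fam /=.
  rewrite -(card_young_diagram pn nk); have [LS _ _] := lin_extP _ _ _ _ _ _ LL.
  have Linj : {in young_diagram k nu &, injective (lower_filling T)}.
    move=> d d' /(young_diagram_cellP a)[c r l] /(young_diagram_cellP a)[c' r' l'].
    rewrite !ffunE -r -l -r' -l' !entryE => e.
    have cr : cell_row c != 0 by rewrite r.
    have cc' := entries_inj hb (standard_lower_neq0 pla st cr) e.
    move: r l; rewrite cc' r' l'; case: d d' {r' l'} => i j [i' j'] /= [] /val_inj ->.
    by move/val_inj ->.
  by rewrite -LS card_in_imset.
- case=> -[U M] L; rewrite inE /= inE /= => /andP[/andP[mp /eqP cM] LL].
  have [pP dUM Ua] := facts U M mp cM.
  rewrite inE (build_standard pn _ nk Ua pP dUM LL) //=.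
  have hb := build_has_blocks pn (esym cM) nk (leq_trans (leq_addr _ _) Ua) pP dUM LL.
  by rewrite (family_tableauE hb size2); case/and5P: mp => _ _ -> -> ->.
- by move=> T; rewrite inE => /andP[st fam] /=; rewrite standard_buildK.
case=> -[U M] L; rewrite inE /= inE /= => /andP[/andP[mp /eqP cM] LL].
have [pP dUM Ua] := facts U M mp cM.
have hb := build_has_blocks pn (esym cM) nk (leq_trans (leq_addr _ _) Ua) pP dUM LL.
have [-> ->] := has_blocksE hb; congr pair; apply/ffunP => d; rewrite ffunE.
have [dS|dS] := boolP (d \in young_diagram k nu).
  have [c r l] := young_diagram_cellP a dS.
  by rewrite -r -l entryE (build_tableau_lower _ _ r l).
have [_ -> //] := lin_extP _ _ _ _ _ _ LL.
by rewrite entry_default //; move: dS; rewrite inE -leqNgt.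
Qed.

Lemma nsyt_one_row nu : is_part nu -> size nu <= 1 -> nsyt nu = 1.
Proof.
move e : (sumn nu) => m; elim: m nu e => [|m IH] nu e pn s1; first by rewrite /nsyt e.
case: nu e pn s1 => [|x [|//]] //=; rewrite addn0 => -> pn _.
rewrite -sum_down_nsyt // /down /= /removable /= /decr_row /=.
rewrite big_seq1; case: m IH {pn} => [|m] IH /=; first by [].
by rewrite IH //= addn0.
Qed.

Lemma irr_index_spec A k nu : irr_index A k nu ->
  [/\ is_part nu, sumn nu <= k & planar_family A ==> (size nu <= 1)].
Proof.
case/andP => pn; case: A => /=; do ?[case/and3P|case/andP|move/eqP ->] => *; split => //.
Qed.

(** * Dimensions of the irreducible representations *)

Import GRing.Theory.
Local Open Scope ring_scope.

(** There is a single partition of the empty set of vertices. *)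
Lemma diagram0 (d : diagram 0) : d = id_diagram 0.
Proof.
apply: val_inj => /=.
have E (P : {set {set vertex 0}}) : partition P setT -> P = set0.
  move=> pP; apply/eqP; rewrite -partition_set0; suff <- : setT = set0 :> {set vertex 0} by [].
  by apply/setP => -[[]|[]].
by rewrite (E _ (blocksP d)) (E _ (id_diagram_subproof 0)).
Qed.

Lemma irreducible0_dim A K n (W : diag_rep K 0) :
  is_irreducible A n W -> \dim {:W} = 1%N.
Proof.
case=> -[lin _ one] dn0 sub.
have act0 : rep_act W 0 = 0.
  have := lin 1 0 0 (mem0v _) (mem0v _).
  by rewrite scale1r addr0 scale1r => /eqP; rewrite -subr_eq0 opprD addrA subrr sub0r oppr_eq0 => /eqP.
have scal (x : palg K 0) : x \in family_alg A K 0 ->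
    exists c : K, rep_act W x = c *: \1%VF.
  move=> xA; pose c : K := x (id_diagram 0).
  have xe : x = c *: palg_one K 0.
    by apply/ffunP => d; rewrite !ffunE (diagram0 d) eqxx /= mulr1n [RHS]mulr1.
  exists c; have [c0|cn0] := eqVneq c 0; first by rewrite xe c0 !scale0r act0.
  have oA : palg_one K 0 \in family_alg A K 0.
    by have := memvZ c^-1 xA; rewrite xe scalerA mulVf // scale1r.
  by have := lin c _ 0 oA (mem0v _); rewrite addr0 -xe act0 addr0 one.
have vn0 : vpick {:W} != 0.
  by rewrite vpick0; apply: contraNneq dn0 => ->; rewrite dimv0.
(* The algebra acts by scalars, so that every line is a subrepresentation. *)
have [x /scal [c ->]|e|e] := sub <[vpick {:W}]>%VS.
- by rewrite limg_line -memvE lfunE /= id_lfunE memvZ ?memv_line.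
- by move: vn0; rewrite -memv0 -e memv_line.
by rewrite -e dim_vline vn0.
Qed.

Lemma dim_direct_sum A K k (W : diag_rep K k) (I : finType) (U : I -> diag_rep K k) :
  is_direct_sum A W U -> \dim {:W} = (\sum_i \dim {:U i})%N.
Proof.
case=> f [inj dir tot]; rewrite -tot (directvP dir) /=.
apply: eq_bigr => i _; apply: limg_dim_eq.
by have [_ /eqP ->] := inj i; rewrite capv0.
Qed.

Theorem dim_irreducible A K n k (V : forall j, seq nat -> diag_rep K j) j nu :
  standard_irreps A n k V -> (j <= k)%N -> irr_index A j nu ->
  \dim {:V j nu} = (marked_count A j (sumn nu) * shape_count A nu)%N.
Proof.
move=> [irr _ _ branch]; elim: j nu => [|j IH] nu jk nuI.
  rewrite (irreducible0_dim (irr _ _ jk nuI)).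
  have /andP[pn _] := nuI.
  have -> : nu = [::].
    apply/eqP; rewrite -sumn_eq0 // -leqn0.
    by move: nuI; case: A {irr branch} => /andP[_] //;
      do ?[case/andP=> // ?|case/and3P=> // ? ?] => /eqP ->.
  by rewrite /shape_count; case: A {irr branch nuI}.
have /andP[pn _] := nuI.
have [s scount dir] := branch j nu jk nuI.
have -> : \dim {:V j.+1 nu} = (\sum_(x <- s) \dim {:V j x})%N.
  by rewrite [LHS](dim_direct_sum dir) (big_nth [::]) big_mkord.
rewrite -sum_constituents //; last first.
  by move: nuI; case: A {irr branch dir scount IH} => //= /andP[_] => [/and3P[]|/andP[]|/andP[]|/andP[]].
pose F x := (marked_count A j (sumn x) * shape_count A x)%N.
have sI x : x \in s -> irr_index A j x.
  rewrite -has_pred1 has_count scount; by case: ifP.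
have sF : (\sum_(x <- s) \dim {:V j x} = \sum_(x <- s) F x)%N.
  by rewrite !big_seq; apply: eq_bigr => x /sI xI; rewrite (IH x (ltnW jk) xI).
(* The constituents outside the index set contribute nothing to the sum, so
   they can be added to those of the restriction. *)
have pe : perm_eq s [seq x <- constituents A nu | irr_index A j x].
  apply/allP => x _ /=; rewrite scount count_filter.
  case: ifP => xI; last first.
    by apply/eqP; rewrite (eq_count (a2 := pred0)) ?count_pred0 // => y /=;
       case: eqP => // ->; rewrite xI.
  rewrite (eq_count (a2 := pred1 x)); last by move=> y /=; case: eqP => // ->.
  by rewrite count_constituents //; case/andP: xI.
rewrite sF (perm_big _ pe) big_filter big_mkcond /= !big_seq; apply: eq_bigr => x xc.
case: ifP => // /negbT xI.
by rewrite marked_count_vanish // (constituents_part pn xc).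
Qed.

Theorem corollary6p16 (R : realType) (A : alg_family) (k n : nat) (la : seq nat)
    (V : forall j : nat, seq nat -> diag_rep R[i] j) :
  (0 < k)%N -> (2 * k <= n)%N -> partition_of n la ->
  standard_irreps A n k V ->
  irr_index A k (behead la) ->
  \dim {:V k (behead la)} = #|SMT A k la|.
Proof.
move=> k0 kn /andP[pla /eqP sla] irr nuI.
rewrite (dim_irreducible irr (leqnn k) nuI).
case: la pla sla nuI => [_ /= e|a nu pla /= sla nuI]; first by lia.
have [pn nk pl] := irr_index_spec nuI.
rewrite card_SMT ?sla //.
have -> : [set: 'I_k] = [set i : 'I_k | (i < k)%N] by apply/setP => i; rewrite !inE ltn_ord.
rewrite card_marked_partitions // /shape_count.
by case: ifP pl => // _ /= s1; rewrite s1 nsyt_one_row.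
Qed.
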